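(* Let $\Omega(t)\subset\mathbb{R}^N$ be a $T$-periodic domain and let $\mu$ be the principal periodic eigenvalue of $\Omega(t)$. At each fixed time $0\le t\le T$, let $\lambda(\Omega(t))$ be the principal eigenvalue of $-\nabla^2$ on the domain $\Omega(t)$ with zero Dirichlet boundary conditions. Then $$\mu\ \ge\ \frac1T\int_0^T D\,\lambda(\Omega(t))\,dt .$$
   Context: $D>0$ and $T>0$ are constants. A $T$-periodic domain means a family of bounded, connected open sets $\Omega(t)\subset\mathbb{R}^N$, $t\in\mathbb{R}$, with $\Omega(t+T)=\Omega(t)$, subject to the following standing assumption. There are a bounded connected reference domain $\Omega_0\subset\mathbb{R}^N$ with boundary of class at least $C^{2+\varepsilon}$ for some $\varepsilon>0$, and one-to-one maps $h(\cdot,t):\overline{\Omega(t)}\to\overline{\Omega_0}$, $T$-periodic in $t$, transforming $\Omega(t)$ into $\Omega_0$, such that the change of variables $\xi=h(x,t)$, $u(\xi,t)=\psi(x,t)$ transforms the problem $\partial_t\psi=D\nabla^2\psi+f(\psi)$ in $\Omega(t)$, $\psi=0$ on $\partial\Omega(t)$, into $\partial_t u=\mathcal{L}(\xi,t)u+f(u)$ in $\Omega_0$, $u=0$ on $\partial\Omega_0$, where $$\mathcal{L}(\xi,t)u=\sum_{i,j}a_{ij}(\xi,t)\frac{\partial^2u}{\partial\xi_i\partial\xi_j}+\sum_j\big(b_j(\xi,t)+c_j(\xi,t)\big)\frac{\partial u}{\partial\xi_j},$$ $$a_{ij}=\sum_k D\frac{\partial h_i}{\partial x_k}\frac{\partial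 h_j}{\partial x_k},\qquad b_j=-\frac{\partial h_j}{\partial t},\qquad c_j=D\nabla^2h_j$$ (the right-hand sides being evaluated at the point $x$ with $h(x,t)=\xi$). It is assumed that $a_{ij},b_j,c_j\in C^{\alpha,\alpha/2}(\overline{\Omega_0}\times[0,T])$ for some $\alpha>0$ and that $(a_{ij})$ is uniformly elliptic. The principal periodic eigenvalue of $\Omega(t)$ is the unique real number $\mu$ for which there is a function $\phi(\xi,t)$ (unique up to scaling) satisfying $\partial_t\phi-\mathcal{L}\phi=\mu\phi$ for $\xi\in\Omega_0$, $t\in\mathbb{R}$; $\phi=0$ for $\xi\in\partial\Omega_0$; $\phi>0$ for $\xi\in\Omega_0$; and $\phi(\xi,t)\equiv\phi(\xi,t+T)$. (Existence and uniqueness are known, by Castro and Lazer.) *)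

(* Defs.v *)
From HB Require Import structures.
From mathcomp Require Import all_boot all_order all_algebra.
From mathcomp Require Import all_classical all_reals all_analysis.

Set Implicit Arguments.
Unset Strict Implicit.
Unset Printing Implicit Defensive.

Import Order.TTheory GRing.Theory Num.Theory.
Import numFieldNormedType.Exports.

Local Open Scope classical_set_scope.
Local Open Scope ring_scope.

(* R^N is 'rV[R]_N, whose norm is the sup norm; it is used only for topology,
   boundedness and Hoelder conditions, which do not depend on the norm.
   Space-time functions are curried, position first; space-time sets live in
   'rV[R]_N * R. *)

Definition partial (R : realType) (N : nat) (i : 'I_N)
    (f : 'rV[R]_N -> R) (x : 'rV[R]_N) : R :=
  'D_(delta_mx 0 i) f x.

Definition laplacian (R : realType) (N : nat)
    (f : 'rV[R]_N -> R) (x : 'rV[R]_N) : R :=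
  \sum_(i < N) partial i (partial i f) x.

Definition boundary (X : topologicalType) (A : set X) : set X :=
  closure A `\` interior A.

Definition bounded_domain (R : realType) (N : nat) (A : set 'rV[R]_N) : Prop :=
  [/\ A !=set0, open A, connected A & bounded_set A].

(* For U open. *)
Definition C2 (R : realType) (N : nat) (U : set 'rV[R]_N)
    (f : 'rV[R]_N -> R) : Prop :=
  forall x, U x ->
    [/\ {for x, continuous f},
        (forall i : 'I_N,
           derivable f x (delta_mx 0 i) /\ {for x, continuous (partial i f)})
      & (forall i j : 'I_N,
           derivable (partial i f) x (delta_mx 0 j) /\
           {for x, continuous (partial j (partial i f))})].

(* For Q open in space-time: C^2 in space, C^1 in time, all these derivatives
   being continuous jointly in (x, t). *)
Definition C21 (R : realType) (N : nat) (Q : set ('rV[R]_N * R))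
    (f : 'rV[R]_N -> R -> R) : Prop :=
  forall x t, Q (x, t) ->
    [/\ {for (x, t), continuous (fun p : 'rV[R]_N * R => f p.1 p.2)},
        derivable (f x) t 1 /\
        {for (x, t), continuous (fun p : 'rV[R]_N * R => derive1 (f p.1) p.2)},
        (forall i : 'I_N,
           derivable (f^~ t) x (delta_mx 0 i) /\
           {for (x, t), continuous
              (fun p : 'rV[R]_N * R => partial i (f^~ p.2) p.1)})
      & (forall i j : 'I_N,
           derivable (partial i (f^~ t)) x (delta_mx 0 j) /\
           {for (x, t), continuous
              (fun p : 'rV[R]_N * R => partial j (partial i (f^~ p.2)) p.1)})].

Definition hoelder (R : realType) (N : nat) (e : R) (U : set 'rV[R]_N)
    (f : 'rV[R]_N -> R) : Prop :=
  exists C : R, forall x y, U x -> U y -> `|f x - f y| <= C * `|x - y| `^ e.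

(* Boundary of class C^{2+e}: near each boundary point, after relabelling and
   possibly reversing a coordinate axis, A is the region above the graph of a
   C^{2+e} function of the N - 1 remaining coordinates (col' k x is x with its
   k-th coordinate removed). *)
Definition C2e_boundary (R : realType) (N : nat) (e : R)
    (A : set 'rV[R]_N) : Prop :=
  forall x0, boundary A x0 ->
  exists (r : R) (k : 'I_N) (reverse : bool) (gamma : 'rV[R]_(N.-1) -> R),
    [/\ 0 < r,
        C2 (ball (col' k x0) r) gamma,
        (forall i j : 'I_(N.-1),
           hoelder e (ball (col' k x0) r) (partial j (partial i gamma)))
      & (forall x, ball x0 r x ->
           A x <-> gamma (col' k x) < (-1) ^+ reverse * x 0 k)].

(* The space C^{alpha,alpha/2} of the closure of U times [0, T], for U bounded.
   The condition is imposed on U times [0, T]; such functions are exactly those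
   with a (unique) Hoelder extension to the closure. *)
Definition parabolic_hoelder (R : realType) (N : nat) (alpha T : R)
    (U : set 'rV[R]_N) (f : 'rV[R]_N -> R -> R) : Prop :=
  exists C : R, forall x y s t, U x -> U y -> 0 <= s <= T -> 0 <= t <= T ->
    `|f x s - f y t| <= C * (`|x - y| `^ alpha + `|s - t| `^ (alpha / 2)).

(* Coefficients of the transformed operator. Here hinv (., t) is the inverse of
   h (., t), so that hinv xi t is the point x with h (x, t) = xi. *)
Definition coef_a (R : realType) (N : nat) (D : R)
    (h hinv : 'rV[R]_N -> R -> 'rV[R]_N) (i j : 'I_N)
    (xi : 'rV[R]_N) (t : R) : R :=
  \sum_(k < N) D * partial k (fun x => h x t 0 i) (hinv xi t)
                 * partial k (fun x => h x t 0 j) (hinv xi t).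

Definition coef_b (R : realType) (N : nat)
    (h hinv : 'rV[R]_N -> R -> 'rV[R]_N) (j : 'I_N)
    (xi : 'rV[R]_N) (t : R) : R :=
  - derive1 (fun s => h (hinv xi t) s 0 j) t.

Definition coef_c (R : realType) (N : nat) (D : R)
    (h hinv : 'rV[R]_N -> R -> 'rV[R]_N) (j : 'I_N)
    (xi : 'rV[R]_N) (t : R) : R :=
  D * laplacian (fun x => h x t 0 j) (hinv xi t).

Definition operator_L (R : realType) (N : nat) (D : R)
    (h hinv : 'rV[R]_N -> R -> 'rV[R]_N)
    (u : 'rV[R]_N -> R -> R) (xi : 'rV[R]_N) (t : R) : R :=
  \sum_(i < N) \sum_(j < N)
     coef_a D h hinv i j xi t * partial i (partial j (u^~ t)) xi
  + \sum_(j < N)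
     (coef_b h hinv j xi t + coef_c D h hinv j xi t) * partial j (u^~ t) xi.

(* A T-periodic domain Omega with reference domain Omega0 and straightening
   maps h. By the chain rule, the regularity pd_open, pd_C21, pd_cont and
   pd_contV is what makes xi = h (x, t) turn classical solutions of
     psi_t = D laplacian psi + f psi  in Omega t,  psi = 0 on its boundary
   into classical solutions of
     u_t = L u + f u  in Omega0,  u = 0 on its boundary,
   with L the operator operator_L. *)
Record periodic_domain (R : realType) (N : nat) (D T : R)
    (Omega : R -> set 'rV[R]_N) (Omega0 : set 'rV[R]_N)
    (h hinv : 'rV[R]_N -> R -> 'rV[R]_N) : Prop := PeriodicDomain {
  pd_domain : forall t, bounded_domain (Omega t) ;
  pd_periodic : forall t, Omega (t + T) = Omega t ;
  pd_ref_domain : bounded_domain Omega0 ;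
  pd_ref_smooth : exists e : R, 0 < e < 1 /\ C2e_boundary e Omega0 ;
  pd_hK : forall t x, closure (Omega t) x ->
    closure Omega0 (h x t) /\ hinv (h x t) t = x ;
  pd_hinvK : forall t xi, closure Omega0 xi ->
    closure (Omega t) (hinv xi t) /\ h (hinv xi t) t = xi ;
  pd_image : forall t, [set h x t | x in Omega t] = Omega0 ;
  pd_h_periodic : forall t x, closure (Omega t) x -> h x (t + T) = h x t ;
  pd_open : open [set p : 'rV[R]_N * R | Omega p.2 p.1] ;
  pd_C21 : forall i : 'I_N,
    C21 [set p : 'rV[R]_N * R | Omega p.2 p.1] (fun x t => h x t 0 i) ;
  pd_cont : {within [set p : 'rV[R]_N * R | closure (Omega p.2) p.1],
    continuous (fun p : 'rV[R]_N * R => h p.1 p.2)} ;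
  pd_contV : {within closure Omega0 `*` [set: R],
    continuous (fun p : 'rV[R]_N * R => hinv p.1 p.2)} ;
  pd_hoelder : exists alpha : R, [/\ 0 < alpha < 1,
    (forall i j : 'I_N, parabolic_hoelder alpha T Omega0 (coef_a D h hinv i j)),
    (forall j : 'I_N, parabolic_hoelder alpha T Omega0 (coef_b h hinv j))
    & (forall j : 'I_N, parabolic_hoelder alpha T Omega0 (coef_c D h hinv j))] ;
  pd_elliptic : exists kappa : R, 0 < kappa /\
    forall xi t (z : 'rV[R]_N), Omega0 xi -> 0 <= t <= T ->
      kappa * \sum_(i < N) z 0 i ^+ 2 <=
      \sum_(i < N) \sum_(j < N) coef_a D h hinv i j xi t * z 0 i * z 0 j
}.

(* "mu is the principal periodic eigenvalue": mu has a positive periodic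
   classical eigenfunction. *)
Definition principal_periodic_eigenvalue (R : realType) (N : nat) (D T : R)
    (Omega0 : set 'rV[R]_N) (h hinv : 'rV[R]_N -> R -> 'rV[R]_N)
    (mu : R) : Prop :=
  exists phi : 'rV[R]_N -> R -> R,
    [/\ C21 (Omega0 `*` [set: R]) phi /\
        {within closure Omega0 `*` [set: R],
           continuous (fun p : 'rV[R]_N * R => phi p.1 p.2)},
        (forall xi t, Omega0 xi ->
           derive1 (phi xi) t - operator_L D h hinv phi xi t = mu * phi xi t),
        (forall xi t, boundary Omega0 xi -> phi xi t = 0),
        (forall xi t, Omega0 xi -> 0 < phi xi t)
      & (forall xi t, closure Omega0 xi -> phi xi (t + T) = phi xi t)].

(* "l is the principal eigenvalue of minus the Laplacian on U with zero
   Dirichlet boundary conditions": l has a positive classical eigenfunction. *)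
Definition dirichlet_principal_eigenvalue (R : realType) (N : nat)
    (U : set 'rV[R]_N) (l : R) : Prop :=
  exists v : 'rV[R]_N -> R,
    [/\ C2 U v /\ {within closure U, continuous v},
        (forall x, U x -> - laplacian v x = l * v x),
        (forall x, boundary U x -> v x = 0)
      & (forall x, U x -> 0 < v x)].

(* Main.v *)
Require Import Defs.
From HB Require Import structures.
From mathcomp Require Import all_boot all_order all_algebra.
From mathcomp Require Import all_classical all_reals all_analysis.
From mathcomp Require Import ring lra.

Set Implicit Arguments.
Unset Strict Implicit.
Unset Printing Implicit Defensive.

Import Order.TTheory GRing.Theory Num.Theory.
Import numFieldNormedType.Exports.

Local Open Scope classical_set_scope.
Local Open Scope ring_scope.

(** The idea is an energy estimate. Let phi be the principal eigenfunction and
    psi (x, t) = phi (h (x, t), t) its pullback to the moving domain; by the chain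
    rule psi_t = D lap psi + mu psi there (pullback_heat). If E (t) denotes the
    integral of psi ^ 2 over Omega t, then, since psi vanishes on the boundary,
      E' = - 2 D (integral of |grad psi| ^ 2) + 2 mu E
         <= 2 (mu - D lambda (Omega t)) E,
    so D lambda (Omega t) <= mu - E' / (2 E). Integrating over a period makes
    the logarithmic derivative disappear, because E is periodic.

    Three points need care.

    Boundary regularity. Nothing is known about the derivatives of psi near the
    boundary, so psi is replaced by G (psi), where G = trunc e is the convex
    function (s - e)_+ ^ 3 / s ^ 2. The superlevel set where psi >= e is closed
    (superlevel_closed), hence G (psi) extended by zero is C^2 in space and C^1
    in time. As 0 <= s G' - G <= 3 e, the truncation perturbs the differential
    inequality by O (e) only (energy_rate_le), and e tends to 0 at the end.

    The Rayleigh quotient. The number lambda is only known through a positive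
    eigenfunction v, with no control at the boundary either. Picone's identity
    gives what is needed: the divergence of the compactly supported field
      F = G G' (f) grad f - G ^ 2 (f) grad v / v
    is at least G G' (f) lap f + lambda G ^ 2 (f), the difference being a sum of
    squares (flux_div_ge); integrating it bounds the dissipation by the energy
    (dirichlet_energy).

    The integral over R^N. The proof uses only a few properties of it: it is a
    positive linear form, bounded by the supremum on a box that contains all the
    domains; a partial derivative of a compactly supported C^1 function has
    integral 0; one can differentiate under it; and a nonnegative function that is
    bounded below on some ball has a positive integral. The limit along an
    ultrafilter of the averages over finer and finer lattices has all these
    properties (mean, mean_partial, mean_derive, mean_gt0). The divergence
    theorem for it is the invariance of a lattice sum under a shift by one step.

    Finally, t |-> lambda (Omega t) is not known to be measurable. As it lies below
    a continuous function, the bound on its integral follows from the definition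
    of the integral by suprema over simple functions (le_integral_pointwise). *)

(** * Averages over a lattice in a box *)

(** The lattices below cover the cube of radius M and stick out of it by one mesh
    width, whence the radius M + 1. *)
Definition box (R : realType) (N M : nat) : set 'rV[R]_N :=
  [set x | `|x| <= M.+1%:R].

(** Number of lattice points in each direction, for the mesh 1 / (n + 1): the
    coordinates run from - M to M + 1 / (n + 1). The form m.+2 gives the index set
    a ring structure, whose addition is the cyclic shift. *)
Definition grid_size (M n : nat) : nat := (2 * M * n.+1).+2.

Definition grid_point (R : realType) (N M n : nat)
    (k : 'rV['I_(grid_size M n)]_N) : 'rV[R]_N :=
  \row_i ((k 0 i)%:R / n.+1%:R - M%:R).

Definition grid_mean (R : realType) (N M n : nat) (f : 'rV[R]_N -> R) : R :=
  (#|{: 'rV['I_(grid_size M n)]_N}|%:R)^-1 *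
  \sum_(k : 'rV['I_(grid_size M n)]_N) f (grid_point R k).

Section GridMean.
Variables (R : realType) (N M n : nat).
Implicit Types f g : 'rV[R]_N -> R.

Lemma rV_coord_norm (x : 'rV[R]_N) i : `|x 0 i| <= `|x|.
Proof.
have /mapP[j Hj ->] : `|x 0 i| \in [seq `|x y.1 y.2| | y : 'I_1 * 'I_N].
  by apply/mapP; exists (ord0, i) => //=; rewrite mem_enum.
by rewrite [leRHS]/Num.norm /= mx_normrE; apply/bigmax_geP; right => /=; exists j.
Qed.

Lemma rV_norm_le (x : 'rV[R]_N) (r : R) : 0 <= r ->
  (forall i, `|x 0 i| <= r) -> `|x| <= r.
Proof.
move=> r0 H; rewrite [leLHS]/Num.norm /= mx_normrE; apply/bigmax_leP; split => //.
by move=> [i j] _ /=; rewrite ord1.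
Qed.

Lemma grid_point_box k : box M (@grid_point R N M n k).
Proof.
rewrite /box /=; apply: rV_norm_le => // i.
rewrite mxE ler_norml.
have k0 : 0 <= (k 0 i)%:R / n.+1%:R :> R by rewrite divr_ge0.
have k1 : (k 0 i)%:R / n.+1%:R <= 2 * M%:R + 1 :> R.
  rewrite ler_pdivrMr // -[2]/(2%:R) -natrM natr1 -natrM ler_nat.
  have := ltn_ord (k 0 i); rewrite /grid_size ltnS => /leq_trans; apply.
  by rewrite [ltnRHS]mulSn addSn ltnS leq_addl.
have M0 : 0 <= M%:R :> R by [].
have -> : M.+1%:R = M%:R + 1 :> R by rewrite natr1.
move: k0 k1 M0; set a := _ / _; set m := M%:R => k0 k1 M0.
by apply/andP; split; lra.
Qed.

Lemma card_grid_gt0 : 0 < #|{: 'rV['I_(grid_size M n)]_N}|%:R :> R.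
Proof. by rewrite ltr0n; apply/card_gt0P; exists 0. Qed.

Lemma grid_meanD f g : grid_mean M n (f \+ g) = grid_mean M n f + grid_mean M n g.
Proof. by rewrite /grid_mean big_split mulrDr. Qed.

Lemma grid_meanZ c f : grid_mean M n (fun x => c * f x) = c * grid_mean M n f.
Proof. by rewrite /grid_mean -mulr_sumr mulrCA. Qed.

Lemma grid_mean_le f g : (forall x, box M x -> f x <= g x) ->
  grid_mean M n f <= grid_mean M n g.
Proof.
move=> fg; rewrite /grid_mean ler_pM2l ?invr_gt0 ?card_grid_gt0//.
by apply: ler_sum => k _; apply: fg; exact: grid_point_box.
Qed.

Lemma grid_mean_cst c : grid_mean M n ((fun=> c) : 'rV[R]_N -> R) = c.
Proof.
rewrite /grid_mean big_const iter_addr_0 -[c *+ _]mulr_natl mulrA mulVf ?mul1r//.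
by rewrite gt_eqF// card_grid_gt0.
Qed.

Lemma grid_mean_norm f c : (forall x, box M x -> `|f x| <= c) ->
  `|grid_mean M n f| <= c.
Proof.
move=> fc; rewrite ler_norml -{1}(grid_mean_cst c) -{2}(grid_mean_cst c).
apply/andP; split; last first.
  by apply: grid_mean_le => x /fc; rewrite ler_norml => /andP[].
rewrite -mulN1r -grid_meanZ; apply: grid_mean_le => x /fc.
by rewrite ler_norml mulN1r => /andP[].
Qed.

(** Discrete form of the translation invariance of the integral. *)
Lemma grid_mean_shift f i : (forall x, M%:R <= `|x| -> f x = 0) ->
  grid_mean M n (fun x => f (x + n.+1%:R^-1 *: delta_mx 0 i)) = grid_mean M n f.
Proof.
move=> f0; rewrite /grid_mean; congr (_ * _).
(* The cyclic shift of the index set agrees with the translation except where a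
   point leaves the box, and f vanishes at such a point and at its image. *)
pose s (k : 'rV['I_(grid_size M n)]_N) := k + delta_mx 0 i.
rewrite [RHS](reindex_onto s (fun k => k - delta_mx 0 i)) /=; last first.
  by move=> k _; rewrite /s subrK.
rewrite big_mkcond [RHS]big_mkcond /=; apply: eq_bigr => k _.
rewrite /s addrK eqxx.
have n0 : n.+1%:R != 0 :> R by [].
have [k_lt|k_ge] := ltnP (k 0 i).+1 (grid_size M n).
  congr f; apply/rowP => j; rewrite !mxE eqxx /=.
  have [->|ji] := eqVneq j i; last first.
    by rewrite mulr0 addr0 addn0 modn_small.
  rewrite mulr1 addrAC; congr (_ - _).
  rewrite -[in X in _ + X]div1r -mulrDl natr1; congr (_%:R / _).
  by rewrite (_ : _ (true%:R) = 1%N) // addn1 modn_small.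
have E : nat_of_ord ((k + delta_mx 0 i) 0 i) = modn (k 0 i).+1 (grid_size M n).
  by rewrite !mxE !eqxx /= modnDmr addn1.
have ki : nat_of_ord (k 0 i) = (2 * M * n.+1).+1.
  by apply/eqP; rewrite eqn_leq -ltnS ltn_ord /= -ltnS.
rewrite !f0 //.
all: apply: (le_trans _ (rV_coord_norm _ i)).
  rewrite mxE E ki modnn mul0r.
  by rewrite sub0r normrN ler_norm.
rewrite !mxE !eqxx /= ki mulr1; apply: (le_trans _ (ler_norm _)).
rewrite addrAC lerBrDr -natrD -[X in _ + X]div1r -mulrDl natr1 ler_pdivlMr //.
by rewrite -natrM ler_nat addnn -mul2n; exact: leq_trans (leqnSn _) (leqnSn _).
Qed.

End GridMean.

Section GridMeanLowerBound.
Variables (R : realType) (N M : nat).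

(** The proportion of lattice points in a fixed ball does not tend to 0 as the
    mesh is refined: it is of order (r / (M + 1)) ^ N at least. *)
Lemma grid_mean_ge_ball (x0 : 'rV[R]_N) (r : R) : 0 < r -> `|x0| + r <= M%:R ->
  exists2 kappa : R, 0 < kappa & \forall n \near \oo,
    forall (f : 'rV[R]_N -> R) (c : R), 0 <= c ->
      (forall x, box M x -> 0 <= f x) ->
      (forall x, `|x - x0| <= r -> c <= f x) ->
      kappa * c <= grid_mean M n f.
Proof.
move=> r0 x0r; exists ((r / (2 * (2 * M%:R + 2))) ^+ N).
  by rewrite exprn_gt0// divr_gt0// mulr_gt0// ltr_wpDl// mulr_ge0.
exists (Num.truncn (2 / r)).+1 => // n /= nr f c c0 f0 fc.
have n0 : 0 < n.+1%:R :> R by [].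
have rn : 2 <= r * n.+1%:R.
  rewrite mulrC -ler_pdivrMr//; have := truncnS_gt (2 / r).
  by move/ltW/le_trans; apply; rewrite ler_nat ltnW.
(* A cube of m ^ N lattice points, with m of order r / mesh, fits in the ball. *)
pose m := Num.truncn (r * n.+1%:R).
have r0n : 0 <= r * n.+1%:R by rewrite mulr_ge0// ltW.
have /andP[m_le m_gt] := truncn_itv r0n; rewrite -/m in m_le m_gt.
have m_gt0 : (0 < m)%N by rewrite /m truncn_gt0; apply: le_trans rn; rewrite ler1n.
have xi i : - M%:R <= x0 0 i - r /\ x0 0 i + r <= M%:R.
  have := le_trans (rV_coord_norm x0 i) (ler_norm _).
  have := rV_coord_norm x0 i; rewrite ler_norml => /andP[].
  move: x0r; set a := `|x0|; set b := x0 0 i; set p := M%:R => *; split; lra.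
pose a i := Num.truncn ((x0 0 i + M%:R) * n.+1%:R).
have aP i : (a i)%:R <= (x0 0 i + M%:R) * n.+1%:R < (a i).+1%:R.
  by apply: truncn_itv; rewrite mulr_ge0//; case: (xi i); lra.
have a_lt i (j : 'I_m) : (a i + j < grid_size M n)%N.
  rewrite /grid_size ltnS -(ler_nat R) natrD -natr1 !natrM.
  have jm : j%:R <= m%:R :> R by rewrite ler_nat ltnW.
  have /andP[ai _] := aP i; have [_ xr] := xi i.
  apply: (@le_trans _ _ ((x0 0 i + M%:R) * n.+1%:R + r * n.+1%:R)); first lra.
  rewrite -mulrDl; apply: (@le_trans _ _ (2 * M%:R * n.+1%:R)); last by rewrite lerDl.
  by rewrite ler_pM2r//; lra.
pose phi (j : 'rV['I_m]_N) : 'rV['I_(grid_size M n)]_N :=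
  \row_i inord (a i + j 0 i).
have phiE j i : nat_of_ord (phi j 0 i) = addn (a i) (j 0 i) by rewrite mxE inordK.
have phi_inj : injective phi.
  move=> j j' /rowP jj'; apply/rowP => i; apply/val_inj => /=.
  by have := congr1 val (jj' i); rewrite /= !phiE => /addnI.
have phi_near j : `|grid_point R (phi j) - x0| <= r.
  apply: rV_norm_le => [|i]; first exact: ltW.
  rewrite mxE [(- x0) 0 i]mxE [grid_point _ _ 0 i]mxE phiE natrD mulrDl.
  have /andP[a1 a2] := aP i.
  have jm : (j 0 i)%:R <= m%:R :> R by rewrite ler_nat ltnW.
  rewrite -natr1 in a2.
  have e1 : (a i)%:R / n.+1%:R <= x0 0 i + M%:R by rewrite ler_pdivrMr.
  have e2 : x0 0 i + M%:R <= (a i)%:R / n.+1%:R + r.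
    by rewrite -(ler_pM2r n0) [leRHS]mulrDl divfK ?gt_eqF//; lra.
  have e3 : (j 0 i)%:R / n.+1%:R <= r by rewrite ler_pdivrMr//; lra.
  have e4 : 0 <= (j 0 i)%:R / n.+1%:R :> R by rewrite divr_ge0.
  move: e1 e2 e3 e4; set u := (a i)%:R / _; set v := (j 0 i)%:R / _ => *.
  by rewrite ler_norml; apply/andP; split; lra.
have sum_ge : c * m%:R ^+ N <= \sum_(k : 'rV['I_(grid_size M n)]_N) f (grid_point R k).
  rewrite (bigID [pred k | k \in [set phi j | j : 'rV['I_m]_N]%SET]) /=.
  rewrite -[leLHS]addr0; apply: lerD; last first.
    by apply: sumr_ge0 => k _; apply: f0; exact: grid_point_box.
  rewrite big_imset /=; last by move=> ? ? _ _; exact: phi_inj.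
  apply: (@le_trans _ _ (\sum_(j : 'rV['I_m]_N) c)); last first.
    by apply: ler_sum => j _; apply: fc.
  by rewrite big_const iter_addr_0 card_mx mul1n card_ord -natrX mulr_natr.
rewrite /grid_mean card_mx mul1n card_ord natrX.
have g0 : 0 < (grid_size M n)%:R :> R by [].
rewrite [leRHS]mulrC ler_pdivlMr ?exprn_gt0// mulrAC -exprMn mulrC.
apply: le_trans sum_ge.
rewrite ler_wpM2l// lerXn2r ?nnegrE//.
  by rewrite mulr_ge0// divr_ge0 ?(ltW r0)// mulr_ge0// addr_ge0// mulr_ge0.
rewrite mulrAC ler_pdivrMr; last by rewrite mulr_gt0// ltr_wpDl// mulr_ge0.
have -> : (grid_size M n)%:R = 2 * M%:R * n.+1%:R + 2 :> R.
  by rewrite /grid_size -addn2 natrD !natrM.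
have m2 : r * n.+1%:R <= 2 * m%:R by move: m_gt; rewrite -natr1; lra.
have n1 : 1 <= n.+1%:R :> R by rewrite ler1n.
have M0 : 0 <= M%:R :> R by [].
move: m2 n1 M0; set p := M%:R; set q := n.+1%:R; set z := m%:R => m2 n1 M0.
have rq : 0 <= r * (q - 1) by rewrite mulr_ge0 ?subr_ge0// ltW.
have pz : 0 <= (2 * p + 2) * (2 * z - r * q).
  by rewrite mulr_ge0 ?subr_ge0//; lra.
lra.
Qed.

End GridMeanLowerBound.

(** * A mean on bounded functions *)

(** An ultrafilter decides every set, hence every preimage. *)
Lemma ultra_fmap (S T : Type) (F : set_system S) (f : S -> T) :
  UltraFilter F -> UltraFilter (fmap f F).
Proof.
move=> FU; split; first exact: fmap_proper_filter.
move=> G GP FG; apply/seteqP; split => // A GA.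
have [//|FnA] := in_ultra_setVsetC (f @^-1` A) FU.
have /FG GnA : fmap f F (~` A) by [].
by have /filter_ex [? []] : G (A `&` ~` A) by exact: filterI.
Qed.

(** A normalized integral over the box. A limit along an ultrafilter exists for
    every bounded function at once, and is linear. *)
Definition mean (R : realType) (N : nat) (U : set_system nat) (M : nat)
    (f : 'rV[R]_N -> R) : R :=
  lim (grid_mean M n f @[n --> U]).

Definition box_bounded (R : realType) (N M : nat) (f : 'rV[R]_N -> R) :=
  exists c : R, forall x, box M x -> `|f x| <= c.

Section Mean.
Variables (R : realType) (N : nat) (U : set_system nat).
Hypotheses (UU : UltraFilter U) (ooU : \oo `<=` U).
Variable M : nat.
Implicit Types f g : 'rV[R]_N -> R.

Local Notation mean := (mean U M).

Let UP : ProperFilter U := @ultra_proper _ _ UU.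
Local Existing Instance UP.

(** A bounded sequence converges along an ultrafilter, by compactness of
    segments. *)
Lemma mean_cvg f : box_bounded M f -> grid_mean M n f @[n --> U] --> mean f.
Proof.
move=> [c fc]; apply/cvg_ex.
have UG := ultra_fmap (fun n => grid_mean M n f) UU.
have : compact `[- c, c] by exact: segment_compact.
rewrite compact_ultra => /(_ _ UG)[|p [_ pU]]; last by exists p.
apply: (@filterE _ U) => n /=; rewrite in_itv /= -ler_norml.
exact: grid_mean_norm.
Qed.

Lemma meanE f l : grid_mean M n f @[n --> U] --> l -> mean f = l.
Proof. by move=> H; apply: cvg_lim. Qed.

Lemma meanD f g : box_bounded M f -> box_bounded M g ->
  mean (f \+ g) = mean f + mean g.
Proof.
move=> bf bg; apply: meanE.
under eq_fun do rewrite grid_meanD.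
by apply: cvgD; exact: mean_cvg.
Qed.

Lemma meanZ k f : box_bounded M f -> mean (fun x => k * f x) = k * mean f.
Proof.
move=> bf; apply: meanE.
under eq_fun do rewrite grid_meanZ.
by apply: cvgMr; exact: mean_cvg.
Qed.

Lemma mean_le f g : box_bounded M f -> box_bounded M g ->
  (forall x, box M x -> f x <= g x) -> mean f <= mean g.
Proof.
move=> bf bg fg; apply: ler_lim; [exact: mean_cvg|exact: mean_cvg|].
by apply: filterE => n; apply: grid_mean_le.
Qed.

Lemma mean_norm f c : (forall x, box M x -> `|f x| <= c) -> `|mean f| <= c.
Proof.
move=> fc; have bf : box_bounded M f by exists c.
have /cvg_norm H := mean_cvg bf.
rewrite -(cvg_lim _ H)//; apply: limr_le; first by apply/cvg_ex; exists `|mean f|.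
by apply: filterE => n; exact: grid_mean_norm.
Qed.

Lemma mean_gt0 f (x0 : 'rV[R]_N) (r c : R) : box_bounded M f ->
  0 < r -> `|x0| + r <= M%:R -> 0 < c ->
  (forall x, box M x -> 0 <= f x) -> (forall x, `|x - x0| <= r -> c <= f x) ->
  0 < mean f.
Proof.
move=> bf r0 x0r c0 f0 fc.
have [kappa k0 kP] := grid_mean_ge_ball r0 x0r.
apply: (@lt_le_trans _ _ (kappa * c)); first exact: mulr_gt0.
apply: limr_ge; first by apply/cvg_ex; exists (mean f); exact: mean_cvg.
by apply: ooU; move: kP; apply: filterS => n; apply=> //; exact: ltW.
Qed.

End Mean.

(** * Differentiation under the mean and the divergence theorem *)

(** The mean value theorem without a sign condition on the increment s. *)
Lemma MVT_ball (R : realType) (f : R -> R) (t0 s : R) :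
  (forall t, `|t - t0| <= `|s| -> derivable f t 1) ->
  exists2 c, `|c - t0| <= `|s| & f (t0 + s) - f t0 = s * derive1 f c.
Proof.
move=> df.
have der t : `|t - t0| <= `|s| -> is_derive t 1 f (derive1 f t).
  by move=> /df dt; rewrite derive1E; exact/derivableP.
have cont a b : (forall t, t \in `[a, b]%R -> `|t - t0| <= `|s|) ->
    {within `[a, b], continuous f}.
  move=> H; apply: derivable_within_continuous => t /H; exact: df.
have [s0|s0] := leP 0 s.
  have sub t : t \in `[t0, t0 + s]%R -> `|t - t0| <= `|s|.
    rewrite in_itv /= => /andP[a b]; rewrite (ger0_norm s0) ger0_norm; lra.
  have [|t /subset_itv_oo_cc /sub /der//|c cI ->] :=
    @MVT_segment R f (derive1 f) t0 (t0 + s) _ _ (cont _ _ sub); first lra.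
  exists c; [exact: sub|].
  by rewrite addrAC subrr add0r mulrC.
have sub t : t \in `[t0 + s, t0]%R -> `|t - t0| <= `|s|.
  rewrite in_itv /= => /andP[a b]; rewrite (ltr0_norm s0) ler0_norm; lra.
have [|t /subset_itv_oo_cc /sub /der//|c cI E] :=
    @MVT_segment R f (derive1 f) (t0 + s) t0 _ _ (cont _ _ sub); first lra.
exists c; [exact: sub|].
by rewrite -opprB E -mulrN mulrC; congr (_ * _); lra.
Qed.

(** By the mean value theorem the difference quotient is a value of the derivative
    nearby, so joint continuity of the derivative makes the convergence locally
    uniform in the parameter x. *)
Lemma diffq_near (R : realType) (X : topologicalType) (f : X -> R -> R)
    (x0 : X) (t0 e : R) : 0 < e ->
  (\forall p \near (x0, t0), derivable (f p.1) p.2 1) ->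
  {for (x0, t0), continuous (fun p : X * R => derive1 (f p.1) p.2)} ->
  \forall x \near x0 & s \near (0 : R),
    `|f x (t0 + s) - f x t0 - s * derive1 (f x) t0| <= e * `|s|.
Proof.
move=> e0 df cf.
have e20 : 0 < e / 2 by rewrite divr_gt0.
move: cf => /cvgr_dist_lt /(_ _ e20) cf.
have := filterI df cf.
case=> -[A B] /= [Ax /nbhs_ballP[r /= r0 rB]] AB.
exists (A, ball 0 r) => /=.
  by split => //; exact: nbhsx_ballx.
case=> x s /= [Ax' sr].
have near_t t : `|t - t0| <= `|s| ->
    derivable (f x) t 1 /\ `|derive1 (f x0) t0 - derive1 (f x) t| < e / 2.
  move=> ts; apply: (AB (x, t)); split => //=; apply: rB.
  rewrite /ball /= distrC; apply: le_lt_trans ts _.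
  by move: sr; rewrite /ball /= sub0r normrN.
have [t /near_t[]//|c cs ->] := @MVT_ball R (f x) t0 s.
rewrite -mulrBr normrM mulrC ler_wpM2r//.
have [_ h1] := near_t _ cs; have [|_ h2] := near_t t0; first by rewrite subrr normr0.
rewrite (_ : _ - _ = derive1 (f x0) t0 - derive1 (f x) t0 - (derive1 (f x0) t0 - derive1 (f x) c)); last by ring.
by apply: le_trans (ler_normB _ _) _; lra.
Qed.

Lemma box_compact (R : realType) (N M : nat) : compact (@box R N M).
Proof.
apply: bounded_closed_compact.
  exists M.+1%:R; split => // x xM y; rewrite /box /= => yM.
  exact: le_trans yM (ltW xM).
rewrite (_ : box M = Num.norm @^-1` [set x : R | x <= M.+1%:R]) //.
by apply: closed_comp; [move=> x _; exact: norm_continuous|exact: closed_le].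
Qed.

Lemma continuous_box_bounded (R : realType) (N M : nat) (f : 'rV[R]_N -> R) :
  continuous f -> box_bounded M f.
Proof.
move=> cf.
have : compact (f @` box M).
  by apply: continuous_compact; [exact: continuous_subspaceT|exact: box_compact].
move=> /compact_bounded[c [_ cP]].
by exists (c + 1) => x xM; apply: cP; [rewrite ltrDl|exists x].
Qed.

Lemma is_derive_cvg (R : realType) (V W : normedModType R) (f : V -> W)
    (a v : V) (l : W) :
  h^-1 *: (f (h *: v + a) - f a) @[h --> (0 : R)^'] --> l -> is_derive a v f l.
Proof.
by move=> fl; apply: DeriveDef; [apply/cvg_ex; exists l|exact: cvg_lim].
Qed.

(** Directional derivatives are derivatives along a line; both difference
    quotients are the same function. *)
Lemma is_derive_line (R : realType) (V W : normedModType R) (f : V -> W)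
    (a v : V) (s : R) (l : W) :
  is_derive s 1 (fun r => f (a + r *: v)) l <-> is_derive (a + s *: v) v f l.
Proof.
pose g r := f (a + r *: v).
have E : (fun h => h^-1 *: ((g \o shift s) (h *: (1 : R)) - g s)) =
    (fun h => h^-1 *: ((f \o shift (a + s *: v)) (h *: v) - f (a + s *: v))).
  apply/funext => h; rewrite /g /=; congr (_ *: (f _ - _)).
  by rewrite [h *: 1]mulr1 scalerDl addrCA.
by rewrite -/g; split=> -[dg <-]; apply: DeriveDef; move: dg;
  rewrite /derivable /derive E.
Qed.

Section MeanCalculus.
Variables (R : realType) (N : nat) (U : set_system nat).
Hypotheses (UU : UltraFilter U) (ooU : \oo `<=` U).
Variable M : nat.
Implicit Types f g : 'rV[R]_N -> R.

Local Notation mean := (mean U M).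

Lemma box_boundedZ k f : box_bounded M f -> box_bounded M (fun x => k * f x).
Proof.
move=> [c fc]; exists (`|k| * c) => x /fc; rewrite normrM; exact: ler_wpM2l.
Qed.

Lemma box_boundedD f g : box_bounded M f -> box_bounded M g -> box_bounded M (f \+ g).
Proof.
move=> [c fc] [d gd]; exists (c + d) => x xM.
by apply: le_trans (ler_normD _ _) _; apply: lerD; [exact: fc|exact: gd].
Qed.

Lemma meanB f g : box_bounded M f -> box_bounded M g ->
  mean (fun x => f x - g x) = mean f - mean g.
Proof.
move=> bf bg.
have -> : (fun x => f x - g x) = f \+ (fun x => -1 * g x).
  by apply/funext => x /=; rewrite mulN1r.
by rewrite meanD ?meanZ ?mulN1r//; exact: box_boundedZ.
Qed.

(** Locally uniform convergence is uniform on the compact box, and the mean is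
    continuous for the uniform norm. *)
Lemma mean_cvg_unif (I : Type) (F : set_system I) (FF : Filter F)
    (g : I -> 'rV[R]_N -> R) (g0 : 'rV[R]_N -> R) :
  box_bounded M g0 -> (\forall i \near F, box_bounded M (g i)) ->
  (forall e x, 0 < e -> box M x ->
     \forall y \near x & i \near F, `|g i y - g0 y| <= e) ->
  mean (g i) @[i --> F] --> mean g0.
Proof.
move=> bg0 bg H; apply/cvgrPdistC_le => e e0.
have /compact_near_coveringP/(_ I F (fun i y => `|g i y - g0 y| <= e) FF) :=
  @box_compact R N M.
move=> /(_ (fun x xM => H e x e0 xM)) K.
apply: filterS2 K bg => i Ki bgi.
by rewrite -meanB//; apply: mean_norm.
Qed.

(** Differentiation under the integral: by diffq_near the difference quotients
    converge locally uniformly. *)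
Lemma mean_derive (f : 'rV[R]_N -> R -> R) (t0 : R) :
  (\forall t \near t0, box_bounded M (f^~ t)) ->
  box_bounded M (fun x => derive1 (f x) t0) ->
  (forall x : 'rV[R]_N, \forall p \near (x, t0), derivable (f p.1) p.2 1) ->
  (forall x : 'rV[R]_N, {for (x, t0), continuous (fun p : 'rV[R]_N * R => derive1 (f p.1) p.2)}) ->
  is_derive t0 1 (fun t => mean (f^~ t)) (mean (fun x => derive1 (f x) t0)).
Proof.
move=> bf bdf df cdf.
have bf0 : box_bounded M (f^~ t0) by exact: nbhs_singleton bf.
have bfs : \forall s \near (0 : R)^', box_bounded M (f^~ (t0 + s)).
  by apply: nbhs_dnbhs; move/(@nbhs0P _ R^o): bf.
apply: is_derive_cvg.
have bB s : box_bounded M (f^~ (t0 + s)) -> box_bounded M (fun x => f x (t0 + s) - f x t0).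
  move=> bs; apply: box_boundedD => //.
  by have := box_boundedZ (-1) bf0; under eq_fun do rewrite mulN1r.
have H : mean (fun x => s^-1 * (f x (t0 + s) - f x t0)) @[s --> (0 : R)^'] -->
    mean (fun x => derive1 (f x) t0).
  apply: mean_cvg_unif => //.
    by apply: filterS bfs => s /bB; exact: box_boundedZ.
  move=> e x e0 _.
  have [[A B] /= [Ax B0] AB] := diffq_near e0 (df x) (cdf x).
  exists (A, B `&` [set s | s != 0]) => /=.
    by split => //; exact: (filterI (nbhs_dnbhs B0) (nbhs_dnbhs_neq (0 : R))).
  case=> y s /= [Ay [Bs s0]]; have := AB (y, s) (conj Ay Bs) => /=.
  rewrite (_ : s^-1 * _ - _ = s^-1 * (f y (t0 + s) - f y t0 - s * derive1 (f y) t0)).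
    by rewrite normrM normfV ler_pdivrMl ?normr_gt0// [leRHS]mulrC.
  by rewrite [RHS]mulrBr [s^-1 * (s * _)]mulrA mulVf ?mul1r.
apply: (cvg_trans _ H); apply: near_eq_cvg; apply: filterS bfs => s bs.
by rewrite meanZ ?meanB//; [rewrite [s *: 1]mulr1 [s + t0]addrC|exact: bB].
Qed.

(** The lattice average of the difference quotient over one mesh width is exactly
    0 by shift invariance, and this quotient converges uniformly to the partial
    derivative. *)
Lemma mean_partial (f : 'rV[R]_N -> R) (i : 'I_N) :
  (forall x, M%:R <= `|x| -> f x = 0) ->
  (forall x, derivable f x (delta_mx 0 i)) ->
  continuous (partial i f) ->
  mean (partial i f) = 0.
Proof.
move=> f0 df cdf.
have bd : box_bounded M (partial i f) by exact: continuous_box_bounded.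
pose e : 'rV[R]_N := delta_mx 0 i.
pose F (x : 'rV[R]_N) (s : R) := f (x + s *: e).
have dF (x : 'rV[R]_N) (s : R) : is_derive s (1 : R) (F x) (partial i f (x + s *: e)).
  by apply/is_derive_line; apply: derivableP.
have F'E (x : 'rV[R]_N) (s : R) : derive1 (F x) s = partial i f (x + s *: e).
  by rewrite derive1E; exact: derive_val.
pose g n x := n.+1%:R * (F x n.+1%:R^-1 - F x 0).
have g_mean n : grid_mean M n (g n) = 0.
  rewrite grid_meanZ -[X in _ * grid_mean M n X]/((F^~ n.+1%:R^-1) \+ (fun x => - F x 0)).
  rewrite grid_meanD (grid_mean_shift n i f0).
  rewrite [X in _ + X](_ : _ = - grid_mean M n f) ?subrr ?mulr0//.
  rewrite -mulN1r -grid_meanZ; congr grid_mean; apply/funext => x.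
  by rewrite /F scale0r addr0 mulN1r.
suff /meanE : grid_mean M n (partial i f) @[n --> U] --> (0 : R) by exact.
apply/cvgrPdistC_le => d d0; apply: ooU.
have key x : box M x -> \forall y \near x & n \near \oo, `|g n y - partial i f y| <= d.
  move=> _.
  have [||[A B] /= [Ax B0] AB] := @diffq_near R _ F x 0 d d0.
  - by apply: filterE => p; exact: (@ex_derive _ _ _ _ _ _ _ (dF _ _)).
  - have -> : (fun p : 'rV[R]_N * R => derive1 (F p.1) p.2) =
        (fun p => partial i f (p.1 + p.2 *: e)).
      by apply/funext => p; rewrite F'E.
    apply: (@continuous_comp _ _ _ (fun p : 'rV[R]_N * R => p.1 + p.2 *: e)).
      apply: continuousD; first exact: cvg_fst.
      by apply: continuousZl; exact: cvg_snd.
    exact: cdf.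
  exists (A, [set n | B n.+1%:R^-1]) => /=.
    by split => //; exact: (@cvg_harmonic R _ B0).
  case=> y n /= [Ay Bn]; have := AB (y, n.+1%:R^-1) (conj Ay Bn) => /=.
  rewrite F'E scale0r addr0 add0r => h.
  rewrite (_ : g n y - _ = n.+1%:R * (F y n.+1%:R^-1 - F y 0 - n.+1%:R^-1 * partial i f y)).
    by rewrite normrM mulrC -ler_pdivlMr ?normr_gt0// -normfV.
  by rewrite mulrBr mulrA mulfV ?mul1r.
have /compact_near_coveringP/(_ nat \oo (fun n y => `|g n y - partial i f y| <= d) _ key) :=
  @box_compact R N M.
apply: filterS => n K.
rewrite subr0 (_ : grid_mean M n (partial i f) =
    grid_mean M n (fun x => (-1) * (g n x - partial i f x))).
  by apply: grid_mean_norm => x /K; rewrite normrM normrN1 mul1r.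
rewrite (_ : (fun x => _) = (fun x => (-1) * g n x) \+ partial i f).
  by rewrite grid_meanD grid_meanZ g_mean mulr0 add0r.
by apply/funext => x /=; ring.
Qed.

End MeanCalculus.

(** * Chain rule for functions with continuous partial derivatives *)

Lemma rV_cvg (R : realType) (N : nat) (T : Type) (F : set_system T)
    (FF : Filter F) (f : T -> 'rV[R]_N) (l : 'rV[R]_N) :
  (forall i, f x 0 i @[x --> F] --> l 0 i) -> f x @[x --> F] --> l.
Proof.
move=> fl; apply/cvgrPdist_le => e e0.
have : \forall x \near F, forall i, `|l 0 i - f x 0 i| <= e.
  by apply: filter_forall => i; move: (fl i) => /cvgrPdist_le/(_ _ e0).
apply: filterS => x H; apply: rV_norm_le => [|i]; first exact: ltW.
by rewrite !mxE.
Qed.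

Lemma sum_cvg (R : realType) (T I : Type) (F : set_system T) (FF : Filter F)
    (r : seq I) (f : I -> T -> R) (l : I -> R) :
  (forall i, f i x @[x --> F] --> l i) ->
  \sum_(i <- r) f i x @[x --> F] --> \sum_(i <- r) l i.
Proof. by move=> fl; apply: cvg_big => //; exact: add_continuous. Qed.

Section ChainRule.
Variables (R : realType) (N : nat).
Variables (g : 'rV[R]_N -> R -> R) (x0 : 'rV[R]_N) (t0 : R).
Hypothesis g_der : \forall p \near (x0, t0),
  derivable (g p.1) p.2 1 /\
  forall i : 'I_N, derivable (g^~ p.2) p.1 (delta_mx 0 i).
Hypothesis gt_cont : {for (x0, t0), continuous
  (fun p : 'rV[R]_N * R => derive1 (g p.1) p.2)}.
Hypothesis gx_cont : forall i : 'I_N, {for (x0, t0), continuous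
  (fun p : 'rV[R]_N * R => partial i (g^~ p.2) p.1)}.

(** Total differentiability from continuous partial derivatives, in a form where
    only the partial derivatives of g occur. *)
Lemma increment_near e : 0 < e -> \forall y \near x0 & t \near t0,
  `|g y t - g x0 t0 - (\sum_(i < N) (y - x0) 0 i * partial i (g^~ t0) x0
                        + (t - t0) * derive1 (g x0) t0)|
  <= e * (\sum_(i < N) `|(y - x0) 0 i| + `|t - t0|).
Proof.
move=> e0.
have H2i (i : 'I_N) : \forall p \near (x0, t0),
    `|partial i (g^~ p.2) p.1 - partial i (g^~ t0) x0| <= e.
  by move: (@gx_cont i) => /cvgrPdistC_le/(_ _ e0).
have H2 := filter_forall _ H2i.
have H1 : \forall p \near (x0, t0),
    `|derive1 (g p.1) p.2 - derive1 (g x0) t0| <= e.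
  by move: gt_cont => /cvgrPdistC_le/(_ _ e0).
have [r r0 rP] : exists2 r, 0 < r & forall y t, `|y - x0| < r -> `|t - t0| < r ->
    [/\ derivable (g y) t 1, forall i : 'I_N, derivable (g^~ t) y (delta_mx 0 i),
     `|derive1 (g y) t - derive1 (g x0) t0| <= e &
     forall i : 'I_N, `|partial i (g^~ t) y - partial i (g^~ t0) x0| <= e].
  have [[A B] /= [/nbhs_ballP[r1 /= r10 rA] /nbhs_ballP[r2 /= r20 rB]] AB] :=
    filterI (filterI g_der H1) (H2 (@nbhs_filter ('rV[R]_N * R)%type (x0, t0))).
  exists (Num.min r1 r2); first by rewrite lt_min r10.
  move=> y t; rewrite !lt_min => /andP[yr _] /andP[_ tr].
  have [|[[? ?] ?] ?] // := AB (y, t).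
  by split => /=; [apply: rA|apply: rB]; rewrite -ball_normE /ball_ /= distrC.
exists (ball x0 r, ball t0 r) => /=; first by split; exact: nbhsx_ballx.
case=> y t /= []; rewrite -!ball_normE /ball_ /= distrC => yr.
rewrite distrC => tr.
(* The increment is split along a path that changes the time first and then
   one coordinate after the other. *)
pose z k : 'rV[R]_N := \row_i (if (i < k)%N then y 0 i else x0 0 i).
have z0 : z 0%N = x0 by apply/rowP => i; rewrite mxE.
have zN : z N = y by apply/rowP => i; rewrite mxE ltn_ord.
have step (k : 'I_N) : `|g (z k.+1) t - g (z k) t - (y - x0) 0 k * partial k (g^~ t0) x0|
    <= e * `|(y - x0) 0 k|.
  have zS : z k.+1 = z k + (y - x0) 0 k *: delta_mx 0 k.
    apply/rowP => i; rewrite !mxE eqxx /= ltnS.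
    have [->|ik] := eqVneq i k; first by rewrite leqnn ltnn mulr1 addrC subrK.
    by rewrite mulr0 addr0 ltn_neqAle (_ : (i != k :> nat)) //.
  pose F s := g (z k + s *: delta_mx 0 k) t.
  have zr s : `|s - 0| <= `|(y - x0) 0 k| -> `|z k + s *: delta_mx 0 k - x0| < r.
    rewrite subr0 => sk; apply: le_lt_trans yr; apply: rV_norm_le => // i.
    rewrite !mxE eqxx /=; have [->|ik] := eqVneq i k.
      rewrite ltnn mulr1 addrAC subrr add0r.
      exact: le_trans sk (rV_coord_norm _ _).
    rewrite mulr0 addr0; case: ifP => _; last by rewrite subrr normr0.
    by have := rV_coord_norm (y - x0) i; rewrite !mxE.
  have FD (s : R) : `|s - 0| <= `|(y - x0) 0 k| ->
      is_derive s (1 : R) F (partial k (g^~ t) (z k + s *: delta_mx 0 k)).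
    move=> /zr sr.
    apply/(@is_derive_line R _ _ (g^~ t) (z k) (delta_mx 0 k) s).
    apply: derivableP.
    by have [_ d _ _] := rP _ _ sr tr; exact: d.
  have [s /FD[]//|c ck] := @MVT_ball R F 0 ((y - x0) 0 k).
  rewrite add0r derive1E (@derive_val _ _ _ _ _ _ _ (FD _ ck)) /F -zS scale0r addr0 => ->.
  have [_ _ _ /(_ k) h] := rP _ _ (zr _ ck) tr.
  by rewrite -mulrBr normrM mulrC ler_wpM2r.
have time : `|g x0 t - g x0 t0 - (t - t0) * derive1 (g x0) t0| <= e * `|t - t0|.
  have sr s : `|s - t0| <= `|t - t0| -> `|s - t0| < r by move=> /le_lt_trans; exact.
  have x0r : `|x0 - x0| < r by rewrite subrr normr0.
  have [s /sr /(rP _ _ x0r)[]//|c /sr /(rP _ _ x0r)[_ _ h _]] := @MVT_ball R (g x0) t0 (t - t0).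
  rewrite [t0 + _]addrC subrK => ->.
  by rewrite -mulrBr normrM mulrC ler_wpM2r.
have tele : g y t - g x0 t = \sum_(k < N) (g (z k.+1) t - g (z k) t).
  by rewrite -(big_mkord xpredT (fun k => g (z k.+1) t - g (z k) t)) telescope_sumr// z0 zN.
rewrite (_ : _ - _ - _ = (\sum_(k < N) (g (z k.+1) t - g (z k) t -
    (y - x0) 0 k * partial k (g^~ t0) x0)) +
   (g x0 t - g x0 t0 - (t - t0) * derive1 (g x0) t0)); last first.
  by rewrite sumrB -tele; ring.
rewrite mulrDr; apply: le_trans (ler_normD _ _) _; apply: lerD => //.
rewrite mulr_sumr; apply: le_trans (ler_norm_sum _ _ _) _.
by apply: ler_sum => k _; exact: step.
Qed.

Lemma chain_rule (c : R -> 'rV[R]_N) (tau : R -> R) (s0 : R)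
    (dc : 'I_N -> R) (dtau : R) :
  c s0 = x0 -> tau s0 = t0 ->
  (forall i, is_derive s0 1 (fun s => c s 0 i) (dc i)) ->
  is_derive s0 1 tau dtau ->
  is_derive s0 1 (fun s => g (c s) (tau s))
    (\sum_(i < N) dc i * partial i (g^~ t0) x0 + dtau * derive1 (g x0) t0).
Proof.
move=> cx0 taut0 cD tauD.
pose qc i h := h^-1 *: (c (h *: 1 + s0) 0 i - c s0 0 i).
pose qt h := h^-1 *: (tau (h *: 1 + s0) - tau s0).
have qcl i : qc i h @[h --> (0 : R)^'] --> dc i.
  by case: (cD i) => /[swap] <-.
have qtl : qt h @[h --> (0 : R)^'] --> dtau.
  by case: tauD => /[swap] <-.
pose S h := \sum_(i < N) `|qc i h| + `|qt h|.
have Sl : S h @[h --> (0 : R)^'] --> \sum_(i < N) `|dc i| + `|dtau|.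
  apply: cvgD; last exact: cvg_norm.
  by apply: sum_cvg => i; exact: cvg_norm.
set s1 := _ + _ in Sl.
have s1_ge0 : 0 <= s1 by rewrite addr_ge0// sumr_ge0.
apply: is_derive_cvg.
pose L h := \sum_(i < N) qc i h * partial i (g^~ t0) x0 + qt h * derive1 (g x0) t0.
have Ll : L h @[h --> (0 : R)^'] -->
    \sum_(i < N) dc i * partial i (g^~ t0) x0 + dtau * derive1 (g x0) t0.
  apply: cvgD; last by apply: cvgMl.
  by apply: sum_cvg => i; apply: cvgMl.
rewrite cx0 taut0.
rewrite -[X in _ --> X]addr0.
rewrite (_ : (fun h => _) = (fun h => L h + (h^-1 *: (g (c (h *: 1 + s0)) (tau (h *: 1 + s0)) - g x0 t0) - L h))); last first.
  by apply/funext => h; rewrite [RHS]addrC subrK.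
apply: cvgD => //; apply/cvgrPdistC_le => e e0.
have e1 : 0 < e / (s1 + 1) by rewrite divr_gt0// ltr_wpDl.
have s01 : (s1 < s1 + 1) by rewrite ltrDl.
have near_S : \forall h \near (0 : R)^', S h <= s1 + 1 by exact: (cvgr_le _ Sl).
have [[A B] /= [Ax Bt] AB] := increment_near e1.
have shift_cvg f (l : R) : is_derive s0 1 f l ->
    f (h *: 1 + s0) @[h --> (0 : R)^'] --> f s0.
  case=> /derivable1_diffP /differentiable_continuous fc _.
  apply: (cvg_comp (fun h : R => h *: 1 + s0) f _ fc).
  have H : h *: 1 + s0 @[h --> (0 : R)] --> 0 *: 1 + s0.
    by apply: cvgD; [apply: cvgZl; exact: cvg_id|exact: cvg_cst].
  by move: H; rewrite scale0r add0r; apply: cvg_trans; apply: cvg_app; exact: nbhs_dnbhs.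
have near_A : \forall h \near (0 : R)^', A (c (h *: 1 + s0)).
  have : c (h *: 1 + s0) @[h --> (0 : R)^'] --> x0.
    by rewrite -cx0; apply: rV_cvg => i; exact: shift_cvg (cD i).
  exact.
have near_B : \forall h \near (0 : R)^', B (tau (h *: 1 + s0)).
  by have := shift_cvg _ _ tauD; rewrite taut0; exact.
near=> h.
have h0 : h != 0 by near: h; exact: nbhs_dnbhs_neq.
have Ah : A (c (h *: 1 + s0)) by near: h.
have Bh : B (tau (h *: 1 + s0)) by near: h.
have Sh : S h <= s1 + 1 by near: h.
have := AB (_, _) (conj Ah Bh) => /= bound.
rewrite subr0 (_ : _ - L h = h^-1 * (g (c (h *: 1 + s0)) (tau (h *: 1 + s0)) - g x0 t0
   - (\sum_(i < N) (c (h *: 1 + s0) - x0) 0 i * partial i (g^~ t0) x0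
      + (tau (h *: 1 + s0) - t0) * derive1 (g x0) t0))); last first.
  rewrite [RHS]mulrBr; congr (_ - _); rewrite mulrDr mulr_sumr; congr (_ + _).
    by apply: eq_bigr => i _; rewrite mulrA !mxE /qc cx0.
  by rewrite mulrA /qt taut0.
rewrite normrM normfV ler_pdivrMl ?normr_gt0//; apply: le_trans bound _.
have -> : \sum_(i < N) `|(c (h *: 1 + s0) - x0) 0 i| + `|tau (h *: 1 + s0) - t0| = `|h| * S h.
  rewrite /S mulrDr mulr_sumr /qt taut0 normrM mulrA -normrM mulfV// normr1 mul1r.
  congr (_ + _); apply: eq_bigr => i _.
  by rewrite /qc cx0 normrM mulrA -normrM mulfV// normr1 mul1r !mxE.
rewrite mulrCA ler_wpM2l//.
by rewrite mulrAC ler_pdivrMr ?ltr_wpDl// ler_wpM2l// ltW.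
Unshelve. all: by end_near. Qed.

End ChainRule.

(** * The eigenfunction in the moving domain *)

Lemma near_eq_continuous_at (X Y : topologicalType) (f g : X -> Y) (x : X) :
  (\forall y \near x, f y = g y) -> {for x, continuous g} ->
  {for x, continuous f}.
Proof.
move=> fg; rewrite /prop_for /continuous_at (nbhs_singleton fg); apply: cvg_trans.
by apply: near_eq_cvg; apply: filterS fg.
Qed.

Lemma continuous_at_sum (R : realType) (X : topologicalType) (I : Type)
    (s : seq I) (f : I -> X -> R) (x : X) :
  (forall i, {for x, continuous (f i)}) ->
  {for x, continuous (fun y => \sum_(i <- s) f i y)}.
Proof. by move=> fc; apply: sum_cvg => i; exact: fc. Qed.

Lemma is_derive_line0 (R : realType) (V W : normedModType R) (f : V -> W)
    (a v : V) (l : W) :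
  is_derive (0 : R) 1 (fun r => f (a + r *: v)) l <-> is_derive a v f l.
Proof. by rewrite (is_derive_line f a v 0 l) scale0r addr0. Qed.

Definition pullback (R : realType) (N : nat) (h : 'rV[R]_N -> R -> 'rV[R]_N)
    (phi : 'rV[R]_N -> R -> R) (x : 'rV[R]_N) (t : R) : R :=
  phi (h x t) t.

Section Pullback.
Variables (R : realType) (N : nat) (Q : set ('rV[R]_N * R))
  (Omega0 : set 'rV[R]_N) (h : 'rV[R]_N -> R -> 'rV[R]_N)
  (phi : 'rV[R]_N -> R -> R).
Hypotheses (Qopen : open Q) (O0open : open Omega0)
  (hQ : forall x t, Q (x, t) -> Omega0 (h x t))
  (hC21 : forall i : 'I_N, C21 Q (fun x t => h x t 0 i))
  (phiC21 : C21 (Omega0 `*` [set: R]) phi).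

Local Notation psi := (pullback h phi).

Lemma derivable_near_cylinder (xi : 'rV[R]_N) (t : R) : Omega0 xi ->
  \forall p \near (xi, t), derivable (phi p.1) p.2 1 /\
    forall i : 'I_N, derivable (phi^~ p.2) p.1 (delta_mx 0 i).
Proof.
move=> Oxi; exists (Omega0, setT) => /=.
  by split; [exact: open_nbhs_nbhs|exact: filterT].
case=> y s /= [Oy _]; have [_ [dt _] dx _] := phiC21 (conj Oy I : (Omega0 `*` setT) (y, s)).
by split=> [|i]; [exact: dt|exact: (dx i).1].
Qed.

Lemma straightening_continuous x t : Q (x, t) ->
  {for (x, t), continuous (fun p : 'rV[R]_N * R => h p.1 p.2)}.
Proof. by move=> Qxt; apply: rV_cvg => i; case: (hC21 i Qxt). Qed.

Lemma pullback_continuous (g : 'rV[R]_N -> R -> R) x t : Q (x, t) ->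
  {for (h x t, t), continuous (fun p : 'rV[R]_N * R => g p.1 p.2)} ->
  {for (x, t), continuous (fun p : 'rV[R]_N * R => g (h p.1 p.2) p.2)}.
Proof.
move=> Qxt gc.
apply: (@continuous_comp _ _ _ (fun p : 'rV[R]_N * R => (h p.1 p.2, p.2))
  (fun p => g p.1 p.2)) => //.
exact: (cvg_pair (straightening_continuous Qxt) (@cvg_snd _ _ _ _ _)).
Qed.

(** Chain rule along the image under h of the line through x with direction k. *)
Lemma pullback_partial x t (k : 'I_N) : Q (x, t) ->
  is_derive x (delta_mx 0 k) (psi^~ t)
    (\sum_(j < N) partial k (fun y => h y t 0 j) x * partial j (phi^~ t) (h x t)).
Proof.
move=> Qxt; have Oh := hQ Qxt.
have phiP := phiC21 (conj Oh I : (Omega0 `*` setT) (h x t, t)).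
have := @chain_rule R N phi (h x t) t (derivable_near_cylinder t Oh) _ _
  (fun s => h (x + s *: delta_mx 0 k) t) (cst t) 0
  (fun j => partial k (fun y => h y t 0 j) x) 0.
rewrite scale0r addr0 mul0r addr0.
case: phiP => _ [_ phit] phix _.
move=> /(_ phit (fun i => (phix i).2) erefl erefl) H.
apply/(is_derive_line0 (psi^~ t)); apply: H => i.
apply/(is_derive_line0 (fun y => h y t 0 i)); apply: derivableP.
by have [_ _ hx _] := hC21 i Qxt; exact: (hx k).1.
Qed.

Lemma pullback_time x t : Q (x, t) ->
  is_derive t (1 : R) (psi x)
    (\sum_(j < N) derive1 (fun s => h x s 0 j) t * partial j (phi^~ t) (h x t)
     + derive1 (phi (h x t)) t).
Proof.
move=> Qxt; have Oh := hQ Qxt.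
have phiP := phiC21 (conj Oh I : (Omega0 `*` setT) (h x t, t)).
have := @chain_rule R N phi (h x t) t (derivable_near_cylinder t Oh) _ _
  (h x) id t (fun j => derive1 (fun s => h x s 0 j) t) 1.
case: phiP => _ [_ phit] phix _.
move=> /(_ phit (fun i => (phix i).2) erefl erefl) H.
rewrite -[X in _ + X]mul1r; apply: H => i.
rewrite derive1E; apply: derivableP.
by have [_ [ht _] _ _] := hC21 i Qxt; exact: ht.
Qed.

Lemma pullback_partial2 x t (j k : 'I_N) : Q (x, t) ->
  is_derive x (delta_mx 0 k) (fun y => partial j (phi^~ t) (h y t))
    (\sum_(i < N) partial k (fun y => h y t 0 i) x *
       partial i (partial j (phi^~ t)) (h x t)).
Proof.
move=> Qxt; have Oh := hQ Qxt.
(* freezing the time argument: the first partials of phi need not be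
   differentiable in time *)
pose g y (_ : R) := partial j (phi^~ t) y.
have g_near : \forall p \near (h x t, t), derivable (g p.1) p.2 1 /\
    forall i : 'I_N, derivable (g^~ p.2) p.1 (delta_mx 0 i).
  exists (Omega0, setT) => /=.
    by split; [exact: open_nbhs_nbhs|exact: filterT].
  case=> y s /= [Oy _].
  have [_ _ _ dxx] := phiC21 (conj Oy I : (Omega0 `*` setT) (y, t)).
  by split => [|i]; [exact: derivable_cst|exact: (dxx j i).1].
have gt0 : (fun p : 'rV[R]_N * R => derive1 (g p.1) p.2) = cst 0.
  by apply/funext => p; rewrite derive1_cst.
have gt_cont : {for (h x t, t), continuous
    (fun p : 'rV[R]_N * R => derive1 (g p.1) p.2)}.
  by rewrite gt0; exact: cst_continuous.
have gx_cont (i : 'I_N) : {for (h x t, t), continuous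
    (fun p : 'rV[R]_N * R => partial i (g^~ p.2) p.1)}.
  have [_ _ _ dxx] := phiC21 (conj Oh I : (Omega0 `*` setT) (h x t, t)).
  apply: (@continuous_comp _ _ _ (fun p : 'rV[R]_N * R => (p.1, t))
    (fun p => partial i (partial j (phi^~ p.2)) p.1)).
    exact: (cvg_pair (@cvg_fst _ _ _ _ _) (cvg_cst _)).
  exact: (dxx j i).2.
have := @chain_rule R N g (h x t) t g_near gt_cont gx_cont
  (fun s => h (x + s *: delta_mx 0 k) t) (cst t) 0
  (fun j => partial k (fun y => h y t 0 j) x) 0.
rewrite scale0r addr0 mul0r addr0 => /(_ erefl erefl) H.
apply/(is_derive_line0 (fun y => partial j (phi^~ t) (h y t))); apply: H => i.
apply/(is_derive_line0 (fun y => h y t 0 i)); apply: derivableP.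
by have [_ _ hx _] := hC21 i Qxt; exact: (hx k).1.
Qed.

Lemma section_near x t : Q (x, t) -> \forall y \near x, Q (y, t).
Proof.
move=> Qxt; have [[A B] /= [Ax Bt] AB] : nbhs (x, t) Q by exact: open_nbhs_nbhs.
by apply: filterS Ax => y Ay; apply: (AB (y, t)); split => //=; exact: nbhs_singleton.
Qed.

(** Second partial derivative of the pullback as given by the chain rule. *)
Definition pullback_partial2E (k l : 'I_N) x t := \sum_(j < N)
  (partial l (partial k (fun y => h y t 0 j)) x * partial j (phi^~ t) (h x t)
   + partial k (fun y => h y t 0 j) x *
     \sum_(i < N) partial l (fun y => h y t 0 i) x *
       partial i (partial j (phi^~ t)) (h x t)).

Lemma pullback_second x t (k l : 'I_N) : Q (x, t) ->
  is_derive x (delta_mx 0 l) (partial k (psi^~ t)) (pullback_partial2E k l x t).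
Proof.
move=> Qxt.
have near_eq : \near x, (\sum_(j < N) (fun y => partial k (fun y => h y t 0 j) y) *
    (fun y => partial j (phi^~ t) (h y t))) x = partial k (psi^~ t) x.
  apply: filterS (section_near Qxt) => y Qy.
  rewrite fct_sumE; apply: esym.
  exact: (@derive_val _ _ _ _ _ _ _ (pullback_partial k Qy)).
apply: (near_eq_is_derive near_eq); apply: is_derive_sum => j.
have hD : is_derive x (delta_mx 0 l) (partial k (fun y => h y t 0 j))
    (partial l (partial k (fun y => h y t 0 j)) x).
  by apply: derivableP; have [_ _ _ hxx] := hC21 j Qxt; exact: (hxx k l).1.
apply: is_derive_eq; first exact: (is_deriveM hD (pullback_partial2 j l Qxt)).
by rewrite addrC; congr (_ + _); rewrite [LHS]mulrC.
Qed.

Lemma pullback_C21 : C21 Q psi.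
Proof.
move=> x t Qxt; have Oh := hQ Qxt.
have Q_near : nbhs (x, t) Q by exact: open_nbhs_nbhs.
have [phic [_ phit] phix phixx] := phiC21 (conj Oh I : (Omega0 `*` setT) (h x t, t)).
split.
- exact: pullback_continuous.
- split; first by have [] := pullback_time Qxt.
  apply: (@near_eq_continuous_at _ _ _ (fun p : 'rV[R]_N * R =>
    \sum_(j < N) derive1 (fun s => h p.1 s 0 j) p.2 *
       partial j (phi^~ p.2) (h p.1 p.2) + derive1 (phi (h p.1 p.2)) p.2)).
    by apply: filterS Q_near => -[y s] Qy /=; rewrite [LHS]derive1E; apply: (@derive_val _ _ _ _ _ _ _ (pullback_time Qy)).
  apply: continuousD; last exact: (pullback_continuous (g := fun x t => derive1 (phi x) t) Qxt phit).
  apply: continuous_at_sum => j; apply: continuousM.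
    by have [_ []] := hC21 j Qxt.
  exact: (pullback_continuous (g := fun x t => partial j (phi^~ t) x) Qxt (phix j).2).
- move=> k; split; first by have [] := pullback_partial k Qxt.
  apply: (@near_eq_continuous_at _ _ _ (fun p : 'rV[R]_N * R =>
    \sum_(j < N) partial k (fun y => h y p.2 0 j) p.1 *
       partial j (phi^~ p.2) (h p.1 p.2))).
    by apply: filterS Q_near => -[y s] Qy /=; apply: (@derive_val _ _ _ _ _ _ _ (pullback_partial k Qy)).
  apply: continuous_at_sum => j; apply: continuousM.
    by have [_ _ hx _] := hC21 j Qxt; exact: (hx k).2.
  exact: (pullback_continuous (g := fun x t => partial j (phi^~ t) x) Qxt (phix j).2).
- move=> k l; split; first by have [] := pullback_second k l Qxt.
  apply: (@near_eq_continuous_at _ _ _ (fun p : 'rV[R]_N * R =>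
    pullback_partial2E k l p.1 p.2)).
    by apply: filterS Q_near => -[y s] Qy /=; apply: (@derive_val _ _ _ _ _ _ _ (pullback_second k l Qy)).
  apply: continuous_at_sum => j; apply: continuousD; apply: continuousM.
  + by have [_ _ _ hxx] := hC21 j Qxt; exact: (hxx k l).2.
  + exact: (pullback_continuous (g := fun x t => partial j (phi^~ t) x) Qxt (phix j).2).
  + by have [_ _ hx _] := hC21 j Qxt; exact: (hx k).2.
  apply: continuous_at_sum => i; apply: continuousM.
    by have [_ _ hx _] := hC21 i Qxt; exact: (hx l).2.
  exact: (pullback_continuous (g := fun x t => partial i (partial j (phi^~ t)) x) Qxt (phixx j i).2).
Qed.

End Pullback.

Section HeatEquation.
Variables (R : realType) (N : nat) (D mu : R) (Q : set ('rV[R]_N * R))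
  (Omega0 : set 'rV[R]_N) (h hinv : 'rV[R]_N -> R -> 'rV[R]_N)
  (phi : 'rV[R]_N -> R -> R).
Hypotheses (Qopen : open Q) (O0open : open Omega0)
  (hQ : forall x t, Q (x, t) -> Omega0 (h x t))
  (hC21 : forall i : 'I_N, C21 Q (fun x t => h x t 0 i))
  (phiC21 : C21 (Omega0 `*` [set: R]) phi)
  (hQK : forall x t, Q (x, t) -> hinv (h x t) t = x)
  (phi_eq : forall xi t, Omega0 xi ->
     derive1 (phi xi) t - operator_L D h hinv phi xi t = mu * phi xi t).

(** The coefficients a, b, c of the operator are exactly the ones that the chain
    rule produces, so the two sides agree after a rearrangement of sums. *)
Lemma pullback_heat x t : Q (x, t) ->
  derive1 (pullback h phi x) t =
  D * laplacian (pullback h phi ^~ t) x + mu * pullback h phi x t.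
Proof.
move=> Qxt; rewrite [pullback _ _ x t]/pullback -(phi_eq t (hQ Qxt)) [LHS]derive1E.
rewrite (@derive_val _ _ _ _ _ _ _ (pullback_time O0open hQ hC21 phiC21 Qxt)).
have -> : laplacian (pullback h phi ^~ t) x =
    \sum_(k < N) pullback_partial2E h phi k k x t.
  by apply: eq_bigr => k _; exact: (@derive_val _ _ _ _ _ _ _
    (pullback_second Qopen O0open hQ hC21 phiC21 k k Qxt)).
rewrite /operator_L /coef_a /coef_b /coef_c /laplacian hQK//.
pose a k i := partial k (fun y => h y t 0 i) x.
pose b k i := partial k (partial k (fun y => h y t 0 i)) x.
pose c j := derive1 (fun s => h x s 0 j) t.
pose p j := partial j (phi^~ t) (h x t).
pose q i j := partial i (partial j (phi^~ t)) (h x t).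
rewrite /pullback_partial2E.
rewrite -[X in X + _ = _]/(\sum_(j < N) c j * p j).
rewrite -[X in _ = _ * X + _]/(\sum_(k < N) \sum_(j < N)
  (b k j * p j + a k j * \sum_(i < N) a k i * q i j)).
rewrite -[X in _ = _ + (_ - (X + _))]/(\sum_(i < N) \sum_(j < N)
  (\sum_(k < N) D * a k i * a k j) * q i j).
rewrite -[X in _ = _ + (_ - (_ + X))]/(\sum_(j < N)
  (- c j + D * \sum_(k < N) b k j) * p j).
have -> : \sum_(j < N) (- c j + D * \sum_(k < N) b k j) * p j =
    - (\sum_(j < N) c j * p j) + D * \sum_(k < N) \sum_(j < N) b k j * p j.
  rewrite exchange_big /= mulr_sumr -sumrN -big_split /=; apply: eq_bigr => j _.
  by rewrite mulrDl mulNr -mulrA mulr_suml.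
have -> : \sum_(i < N) \sum_(j < N) (\sum_(k < N) D * a k i * a k j) * q i j =
    D * \sum_(k < N) \sum_(j < N) a k j * \sum_(i < N) a k i * q i j.
  rewrite mulr_sumr exchange_big /=.
  under [RHS]eq_bigr do rewrite mulr_sumr.
  rewrite [RHS]exchange_big /=; apply: eq_bigr => j _.
  under [RHS]eq_bigr do rewrite mulr_sumr mulr_sumr.
  rewrite [RHS]exchange_big /=; apply: eq_bigr => i _.
  by rewrite mulr_suml; apply: eq_bigr => k _; ring.
have -> : \sum_(k < N) \sum_(j < N) (b k j * p j + a k j * \sum_(i < N) a k i * q i j) =
   \sum_(k < N) \sum_(j < N) b k j * p j +
   \sum_(k < N) \sum_(j < N) a k j * \sum_(i < N) a k i * q i j.
  by rewrite -big_split /=; apply: eq_bigr => k _; rewrite big_split.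
by ring.
Qed.

End HeatEquation.

(** * A smooth convex truncation *)

Lemma is_derive_inv (R : realType) (V : normedModType R) (f : V -> R) (x v : V)
    (df : R) : f x != 0 -> is_derive x v f df ->
  is_derive x v (fun y => (f y)^-1) (- (f x) ^- 2 * df).
Proof.
by move=> f0 [fD <-]; apply: DeriveDef; [exact: derivableV|rewrite deriveV].
Qed.

Section Truncation.
Variables (R : realType) (e : R).
Hypothesis e0 : 0 < e.

(** The positive part of s - e. All functions below are of the form
    excess s ^ k * (rational function of s) with k >= 3, hence C^1 at s = e. *)
Definition excess (s : R) : R := Num.max (s - e) 0.
(** This G satisfies G'' = 6 e ^ 2 (s - e)_+ / s ^ 4 >= 0 and differs from s by a
    bounded multiple of e. *)
Definition trunc s := excess s ^+ 3 / s ^+ 2.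
(** G ^ 2 for G = trunc. *)
Definition trunc_sq s := excess s ^+ 6 / s ^+ 4.
(** G G', half the derivative of trunc_sq. *)
Definition trunc_dsq s := excess s ^+ 5 * (s + 2 * e) / s ^+ 5.
(** The derivative G' ^ 2 + G G'' of trunc_dsq. *)
Definition trunc_d2sq s :=
  excess s ^+ 4 * (s ^+ 2 + 4 * e * s + 10 * e ^+ 2) / s ^+ 6.

Lemma excess_ge0 s : 0 <= excess s.
Proof. by rewrite /excess le_max lexx orbT. Qed.

Lemma excess_eq0 s : s <= e -> excess s = 0.
Proof. by move=> se; apply/max_idPr; lra. Qed.

(** Lowering the exponent by the factor s - e, without the positive part, makes the
    derivatives below identities between rational functions. *)
Lemma excessS s n : excess s ^+ n.+2 = (s - e) * excess s ^+ n.+1.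
Proof.
rewrite exprS /excess; case: (lerP (s - e) 0) => [se|//].
by rewrite expr0n /= !mulr0.
Qed.

(** The remainder of the first order expansion is between - h ^ 2 and h ^ 2,
    whatever the position of s and s + h with respect to e. *)
Lemma is_derive_excess_sq s : is_derive s (1 : R) (fun r => excess r ^+ 2) (2 * excess s).
Proof.
apply: is_derive_cvg; apply/cvgrPdistC_le => d d0.
near=> h.
have h0 : h != 0 by near: h; exact: nbhs_dnbhs_neq.
have hd : `|h| <= d by near: h; exact: dnbhs0_le.
rewrite [h *: 1]mulr1; apply: le_trans hd.
rewrite (_ : _ - _ = h^-1 * (excess (h + s) ^+ 2 - excess s ^+ 2 - h * (2 * excess s))).
  rewrite normrM normfV ler_pdivrMl ?normr_gt0// -normrM -expr2.
  rewrite [leRHS]ger0_norm ?sqr_ge0// ler_norml /excess.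
  by apply/andP; split; case: (lerP (h + s - e) 0) => ?; case: (lerP (s - e) 0) => ?; nra.
by rewrite [RHS]mulrBr mulKf.
Unshelve. all: by end_near. Qed.

Lemma is_derive_excess s n : is_derive s (1 : R) (fun r => excess r ^+ n.+2)
  (n.+2%:R * excess s ^+ n.+1).
Proof.
elim: n => [|n IH]; first by rewrite expr1; exact: is_derive_excess_sq.
have -> : (fun r => excess r ^+ n.+3) = (fun r => r - e) * (fun r => excess r ^+ n.+2).
  by apply/funext => r; rewrite excessS.
apply: is_derive_eq.
rewrite subr0 [_ *: 1]mulr1 [_ *: (_ * _)]mulrCA -excessS.
by rewrite -[in RHS](addn1 n.+2) natrD [RHS]mulrDl mul1r.
Qed.

Lemma continuous_excess : continuous excess.
Proof.
move=> s; apply: (@continuous_max _ _ (fun s => s - e) (fun=> 0)).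
  by apply: continuousB; [exact: cvg_id|exact: cst_continuous].
exact: cst_continuous.
Qed.

Lemma is_derive_invX s n : s != 0 ->
  is_derive s (1 : R) (fun r => (r ^+ n)^-1) (- (s ^+ n) ^- 2 * (n%:R * s ^+ n.-1)).
Proof.
move=> s0; apply: is_derive_inv; first by rewrite expf_neq0.
by have := is_deriveX n (is_derive_id s (1 : R)); rewrite [_ *: _]mulr1 exprfctE.
Qed.

Lemma is_derive_trunc_sq (s : R) : 0 < s ->
  is_derive s (1 : R) trunc_sq (2 * trunc_dsq s).
Proof.
move=> s0; have sn0 : s != 0 by rewrite gt_eqF.
apply: (is_derive_eq (is_deriveM (is_derive_excess s 4) (is_derive_invX 4 sn0))).
rewrite -![_ *: _]/(_ * _) /trunc_dsq (excessS s 4) /=.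
by field.
Qed.

Lemma is_derive_trunc_dsq (s : R) : 0 < s ->
  is_derive s (1 : R) trunc_dsq (trunc_d2sq s).
Proof.
move=> s0; have sn0 : s != 0 by rewrite gt_eqF.
have L : is_derive s (1 : R) (fun r => r + 2 * e) 1.
  by apply: is_derive_eq; rewrite addr0.
apply: (is_derive_eq (is_deriveM (is_deriveM (is_derive_excess s 3) L) (is_derive_invX 5 sn0))).
rewrite -![_ *: _]/(_ * _) -[(_ * +%R^~ _) s]/(excess s ^+ 5 * (s + 2 * e)).
by rewrite /trunc_d2sq /= (excessS s 3); field.
Qed.

Lemma continuous_rational (a b : R -> R) s : {for s, continuous a} ->
  {for s, continuous b} -> b s != 0 -> {for s, continuous (fun r => a r / b r)}.
Proof. by move=> ac bc b0; apply: continuousM => //; exact: continuousV. Qed.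

Let exp_cont n : continuous (fun s : R => s ^+ n).
Proof. exact: exprn_continuous. Qed.

Let excess_exp_cont n : continuous (fun s : R => excess s ^+ n).
Proof.
move=> s; apply: (@continuous_comp _ _ _ excess (fun s => s ^+ n)).
  exact: continuous_excess.
exact: exprn_continuous.
Qed.

Lemma continuous_trunc_sq s : 0 < s -> {for s, continuous trunc_sq}.
Proof.
by move=> s0; apply: continuous_rational; rewrite ?expf_neq0 ?gt_eqF//;
  [exact: excess_exp_cont|exact: exp_cont].
Qed.

Lemma continuous_trunc_dsq s : 0 < s -> {for s, continuous trunc_dsq}.
Proof.
move=> s0; apply: continuous_rational; rewrite ?expf_neq0 ?gt_eqF//.
  apply: continuousM; first exact: excess_exp_cont.
  by apply: continuousD; [exact: cvg_id|exact: cst_continuous].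
exact: exp_cont.
Qed.

Lemma continuous_trunc_d2sq s : 0 < s -> {for s, continuous trunc_d2sq}.
Proof.
move=> s0; apply: continuous_rational; rewrite ?expf_neq0 ?gt_eqF//.
  apply: continuousM; first exact: excess_exp_cont.
  apply: continuousD; last exact: cst_continuous.
  apply: continuousD; first exact: exp_cont.
  by apply: continuousM; [exact: cst_continuous|exact: cvg_id].
exact: exp_cont.
Qed.

Lemma trunc_sqE s : trunc_sq s = trunc s ^+ 2.
Proof. by rewrite /trunc_sq /trunc expr_div_n -!exprM. Qed.

Lemma trunc_ge0 s : 0 <= trunc s.
Proof. by rewrite divr_ge0 ?sqr_ge0// exprn_ge0// excess_ge0. Qed.

Lemma trunc_eq0 s : s <= e -> trunc s = 0.
Proof. by move=> se; rewrite /trunc excess_eq0// expr0n mul0r. Qed.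

Lemma trunc_sq_eq0 s : s <= e -> trunc_sq s = 0.
Proof. by move=> se; rewrite trunc_sqE trunc_eq0// expr0n. Qed.

Lemma trunc_dsq_eq0 s : s <= e -> trunc_dsq s = 0.
Proof. by move=> se; rewrite /trunc_dsq excess_eq0// expr0n !mul0r. Qed.

Lemma trunc_d2sq_eq0 s : s <= e -> trunc_d2sq s = 0.
Proof. by move=> se; rewrite /trunc_d2sq excess_eq0// expr0n !mul0r. Qed.

Lemma trunc_gt0 s : e < s -> 0 < trunc s.
Proof.
move=> es; have s0 : 0 < s by exact: lt_trans es.
by rewrite divr_gt0 ?exprn_gt0// /excess lt_max subr_gt0 es.
Qed.

(** This is the only place where the convexity of G enters: the form is
    (G' a - G b) ^ 2 + G G'' a ^ 2. *)
Lemma trunc_form_ge0 s a b : 0 < s ->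
  0 <= trunc_d2sq s * a ^+ 2 - 2 * (trunc_dsq s * a * b) + trunc_sq s * b ^+ 2.
Proof.
move=> s0; have sn0 : s != 0 by rewrite gt_eqF.
rewrite (_ : _ + _ = (excess s ^+ 2 * (s + 2 * e) / s ^+ 3 * a - trunc s * b) ^+ 2
   + 6 * (e * a * excess s ^+ 2 / s ^+ 3) ^+ 2).
  by rewrite addr_ge0 ?sqr_ge0// mulr_ge0 ?sqr_ge0.
rewrite /trunc_d2sq /trunc_dsq /trunc_sq /trunc; by field.
Qed.

(** Quantifies how close G is to the homogeneous function s, for which
    s G G' = G ^ 2. *)
Lemma trunc_dsq_bounds s : 0 < s ->
  trunc_sq s <= s * trunc_dsq s <= trunc_sq s + 3 * e * trunc s.
Proof.
move=> s0; have sn0 : s != 0 by rewrite gt_eqF.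
have [se|es] := lerP s e.
  by rewrite trunc_sq_eq0// trunc_dsq_eq0// trunc_eq0// !mulr0 addr0 lexx.
have qE : excess s = s - e by apply/max_idPl; rewrite subr_ge0 ltW.
have E : s * trunc_dsq s - trunc_sq s = trunc s * (3 * e * (excess s / s) ^+ 2).
  by rewrite /trunc_dsq /trunc_sq /trunc qE; field.
have r0 : 0 <= excess s / s by rewrite divr_ge0 ?excess_ge0// ltW.
have r1 : excess s / s <= 1 by rewrite ler_pdivrMr// qE mul1r gerBl ltW.
have B : 0 <= (excess s / s) ^+ 2 <= 1 by rewrite sqr_ge0 expr_le1.
have t0 := trunc_ge0 s.
have lo : 0 <= trunc s * (3 * e * (excess s / s) ^+ 2).
  by case/andP: B => b _; rewrite mulr_ge0// mulr_ge0// mulr_ge0// ltW.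
have hi : trunc s * (3 * e * (excess s / s) ^+ 2) <= 3 * e * trunc s.
  case/andP: B => _ b; rewrite [leRHS]mulrC ler_wpM2l// ler_piMr// mulr_ge0// ltW//.
by apply/andP; split; lra.
Qed.

End Truncation.

Lemma trunc_anti (R : realType) (e e' s : R) : e <= e' -> 0 < s ->
  trunc e' s <= trunc e s.
Proof.
move=> ee s0; rewrite /trunc ler_pM2r ?invr_gt0 ?exprn_gt0// lerXn2r ?nnegrE ?excess_ge0//.
by rewrite /excess ge_max !le_max lexx orbT andbT; apply/orP; left; lra.
Qed.

(** * The energy inequality on a fixed domain *)

Definition ext0 (R : realType) (X : Type) (A : set X) (f : X -> R) : X -> R :=
  patch (fun=> 0) A f.

Section ExtensionByZero.
Variables (R : realType) (X : Type) (A : set X).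
Implicit Types f g : X -> R.

Lemma ext0_in f x : A x -> ext0 A f x = f x.
Proof. by move=> Ax; rewrite /ext0 patchT// inE. Qed.

Lemma ext0_out f x : ~ A x -> ext0 A f x = 0.
Proof. by move=> Ax; rewrite /ext0 patchC// inE. Qed.

End ExtensionByZero.

Section Gluing.
Variables (R : realType) (X : topologicalType) (A K : set X).
Hypotheses (Aopen : open A) (Kclosed : closed K) (KA : K `<=` A).
Implicit Types f g : X -> R.

Lemma ext0_near_in f x : A x -> \forall y \near x, f y = ext0 A f y.
Proof.
move=> Ax; have : nbhs x A by exact: open_nbhs_nbhs.
by apply: filterS => y Ay; rewrite ext0_in.
Qed.

Lemma ext0_near_out f x : (forall y, A y -> ~ K y -> f y = 0) -> ~ K x ->
  \forall y \near x, 0 = ext0 A f y.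
Proof.
move=> f0 Kx; have : nbhs x (~` K).
  by apply: open_nbhs_nbhs; split => //; exact: closed_openC.
apply: filterS => y Ky; have [Ay|Ay] := pselect (A y); last by rewrite ext0_out.
by rewrite ext0_in// f0.
Qed.

(** The open sets A and the complement of K cover the space; the extension is f on
    the first and 0 on the second. *)
Lemma ext0_continuous f : (forall x, A x -> {for x, continuous f}) ->
  (forall y, A y -> ~ K y -> f y = 0) -> continuous (ext0 A f).
Proof.
move=> fc f0 x; have [Kx|Kx] := pselect (K x).
  apply: near_eq_continuous_at (fc _ (KA Kx)).
  by apply: filterS (ext0_near_in f (KA Kx)) => y ->.
apply: (@near_eq_continuous_at _ _ _ (fun=> 0)); last exact: cst_continuous.
by apply: filterS (ext0_near_out f0 Kx) => y <-.
Qed.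

End Gluing.

Lemma ext0_is_derive (R : realType) (V : normedModType R) (A K : set V)
    (f df : V -> R) (v : V) : open A -> closed K -> K `<=` A ->
  (forall x, A x -> is_derive x v f (df x)) ->
  (forall y, A y -> ~ K y -> f y = 0) -> (forall y, A y -> ~ K y -> df y = 0) ->
  forall x, is_derive x v (ext0 A f) (ext0 A df x).
Proof.
move=> Ao Kc KA fD f0 df0 x; have [Kx|Kx] := pselect (K x).
  rewrite (ext0_in _ (KA _ Kx)).
  exact: near_eq_is_derive (ext0_near_in Ao f (KA _ Kx)) (fD _ (KA _ Kx)).
rewrite -(nbhs_singleton (ext0_near_out Kc df0 Kx)).
by apply: near_eq_is_derive (ext0_near_out Kc f0 Kx) _; exact: is_derive_cst.
Qed.

Lemma is_derive_comp1 (R : realType) (V : normedModType R) (f : V -> R)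
    (g : R -> R) (x v : V) (df dg : R) :
  is_derive x v f df -> is_derive (f x) 1 g dg ->
  is_derive x v (fun y => g (f y)) (dg * df).
Proof.
move=> fD gD; apply/(is_derive_line0 (fun y => g (f y))).
have /(is_derive_line0 f) fD' := fD.
apply: (@is_derive1_comp _ g (fun r : R => f (x + r *: v))) => //.
by rewrite scale0r addr0.
Qed.

Section MeanSum.
Variables (R : realType) (N : nat) (U : set_system nat).
Hypotheses (UU : UltraFilter U) (ooU : \oo `<=` U).
Variables (M : nat) (I : Type) (f : I -> 'rV[R]_N -> R).
Hypothesis bf : forall i, box_bounded M (f i).

Lemma box_bounded_sum (r : seq I) : box_bounded M (fun x => \sum_(i <- r) f i x).
Proof.
elim: r => [|i r IH]; first by exists 0 => x _; rewrite big_nil normr0.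
under eq_fun do rewrite big_cons.
exact: (box_boundedD (bf i) IH).
Qed.

Lemma mean_sum (r : seq I) :
  mean U M (fun x => \sum_(i <- r) f i x) = \sum_(i <- r) mean U M (f i).
Proof.
elim: r => [|i r IH].
  rewrite big_nil; under eq_fun do rewrite big_nil.
  rewrite (_ : (fun=> 0) = fun x : 'rV[R]_N => 0 * (fun=> 0) x).
    by rewrite meanZ ?mul0r//; exists 0 => x _; rewrite normr0.
  by apply/funext => x; rewrite mul0r.
rewrite big_cons -IH -meanD//; last exact: box_bounded_sum.
by congr mean; apply/funext => x /=; rewrite big_cons.
Qed.

End MeanSum.

Section DirichletEnergy.
Variables (R : realType) (N : nat) (U : set_system nat).
Hypotheses (UU : UltraFilter U) (ooU : \oo `<=` U).
Variables (M : nat) (e lambda : R) (A : set 'rV[R]_N) (f v : 'rV[R]_N -> R).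
Hypotheses (e0 : 0 < e) (Aopen : open A) (fC2 : C2 A f) (vC2 : C2 A v)
  (f_gt0 : forall x, A x -> 0 < f x) (v_gt0 : forall x, A x -> 0 < v x)
  (v_eq : forall x, A x -> - laplacian v x = lambda * v x)
  (Kclosed : closed [set x | A x /\ e <= f x])
  (A_box : forall x, A x -> `|x| < M%:R).

Local Notation mean := (mean U M).
Let K := [set x | A x /\ e <= f x].

Let KA : K `<=` A. Proof. by move=> x []. Qed.

Let off_K y : A y -> ~ K y -> f y <= e.
Proof. by move=> Ay Ky; rewrite leNgt; apply/negP => ef; apply: Ky; split => //; exact: ltW. Qed.

Let fc x : A x -> {for x, continuous f}. Proof. by move=> /fC2[]. Qed.
Let vc x : A x -> {for x, continuous v}. Proof. by move=> /vC2[]. Qed.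
Let fD i x : A x -> is_derive x (delta_mx 0 i) f (partial i f x).
Proof. by move=> /fC2[_ fx _]; apply: derivableP; exact: (fx i).1. Qed.
Let vD i x : A x -> is_derive x (delta_mx 0 i) v (partial i v x).
Proof. by move=> /vC2[_ fx _]; apply: derivableP; exact: (fx i).1. Qed.
Let fDD i x : A x -> is_derive x (delta_mx 0 i) (partial i f) (partial i (partial i f) x).
Proof. by move=> /fC2[_ _ fx]; apply: derivableP; exact: (fx i i).1. Qed.
Let vDD i x : A x -> is_derive x (delta_mx 0 i) (partial i v) (partial i (partial i v) x).
Proof. by move=> /vC2[_ _ fx]; apply: derivableP; exact: (fx i i).1. Qed.
Let fDc i x : A x -> {for x, continuous (partial i f)}.
Proof. by move=> /fC2[_ fx _]; exact: (fx i).2. Qed.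
Let vDc i x : A x -> {for x, continuous (partial i v)}.
Proof. by move=> /vC2[_ fx _]; exact: (fx i).2. Qed.
Let fDDc i x : A x -> {for x, continuous (partial i (partial i f))}.
Proof. by move=> /fC2[_ _ fx]; exact: (fx i i).2. Qed.
Let vDDc i x : A x -> {for x, continuous (partial i (partial i v))}.
Proof. by move=> /vC2[_ _ fx]; exact: (fx i i).2. Qed.

Let comp_cont (g : R -> R) x : A x -> (forall s, 0 < s -> {for s, continuous g}) ->
  {for x, continuous (fun y => g (f y))}.
Proof.
by move=> Ax gc; apply: (@continuous_comp _ _ _ f g); [exact: fc|apply: gc; exact: f_gt0].
Qed.

(** Picone's vector field, component i. It is supported where f >= e, so no
    behaviour of f and v at the boundary matters. *)
Definition flux i x := trunc_dsq e (f x) * partial i f x -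
  trunc_sq e (f x) * (partial i v x / v x).

Definition flux_div i x :=
  trunc_d2sq e (f x) * partial i f x ^+ 2 +
  trunc_dsq e (f x) * partial i (partial i f) x -
  (2 * (trunc_dsq e (f x) * partial i f x * (partial i v x / v x)) +
   trunc_sq e (f x) * (partial i (partial i v) x / v x - (partial i v x / v x) ^+ 2)).

Lemma flux_is_derive i x : A x ->
  is_derive x (delta_mx 0 i) (flux i) (flux_div i x).
Proof.
move=> Ax; have f0 := f_gt0 Ax; have v0 : v x != 0 by rewrite gt_eqF// v_gt0.
have D1 := is_deriveM (is_derive_comp1 (fD i Ax) (is_derive_trunc_dsq e f0)) (fDD i Ax).
have D2 := is_deriveM (vDD i Ax) (is_derive_inv v0 (vD i Ax)).
have D3 := is_deriveM (is_derive_comp1 (fD i Ax) (is_derive_trunc_sq e f0)) D2.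
apply: (is_derive_eq (is_deriveB D1 D3)).
rewrite /flux_div -![_ *: _]/(_ * _) -[(_ * _) x]/(_ x * (v x)^-1).
move: f0 v0; set a := partial i f x; set a' := partial i (partial i f) x.
set b := partial i v x; set b' := partial i (partial i v) x.
set H1 := trunc_d2sq _ _; set H := trunc_dsq _ _; set G := trunc_sq _ _.
set c := v x => _ c0.
by field.
Qed.

Lemma flux_div_continuous i x : A x -> {for x, continuous (flux_div i)}.
Proof.
move=> Ax; have v0 : v x != 0 by rewrite gt_eqF// v_gt0.
have c0 := comp_cont Ax (continuous_trunc_sq (e := e)).
have c1 := comp_cont Ax (continuous_trunc_dsq (e := e)).
have c2 := comp_cont Ax (continuous_trunc_d2sq (e := e)).
have cV : {for x, continuous (fun y => (v y)^-1)} by apply: continuousV => //; exact: vc.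
have cq : {for x, continuous (fun y => partial i v y / v y)}.
  by apply: continuousM => //; exact: vDc.
apply: continuousB.
  apply: continuousD; apply: continuousM => //; last exact: fDDc.
  by apply: continuousM; exact: fDc.
apply: continuousD; apply: continuousM => //.
- exact: cst_continuous.
- by apply: continuousM => //; apply: continuousM => //; exact: fDc.
- apply: continuousB; last exact: continuousM.
  by apply: continuousM => //; exact: vDDc.
Qed.

Let flux_div0 i y : A y -> ~ K y -> flux_div i y = 0.
Proof.
move=> Ay /(off_K Ay) fe.
by rewrite /flux_div trunc_dsq_eq0// trunc_sq_eq0// trunc_d2sq_eq0// !(mul0r, mulr0, addr0, subrr).
Qed.

Lemma flux_div_mean i : mean (ext0 A (flux_div i)) = 0.
Proof.
have flux0 y : A y -> ~ K y -> flux i y = 0.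
  move=> Ay /(off_K Ay) fe.
  by rewrite /flux trunc_dsq_eq0// trunc_sq_eq0// !mul0r subrr.
have div0 := @flux_div0 i.
have D := ext0_is_derive Aopen Kclosed KA (flux_is_derive i) flux0 div0.
have E : partial i (ext0 A (flux i)) = ext0 A (flux_div i).
  by apply/funext => x; exact: (@derive_val _ _ _ _ _ _ _ (D x)).
rewrite -E; apply: mean_partial => //.
- by move=> x Mx; apply: ext0_out => /A_box; rewrite ltNge Mx.
- have cont := ext0_continuous Aopen Kclosed KA (@flux_div_continuous i) div0.
  by rewrite E; exact cont.
Qed.

(** After substituting lambda = - lap v / v, the difference of the two sides is
    the sum over i of the quadratic form of trunc_form_ge0 at
    a = partial i f and b = partial i v / v. *)
Lemma flux_div_ge x : A x ->
  trunc_dsq e (f x) * laplacian f x + lambda * trunc_sq e (f x) <=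
  \sum_(i < N) flux_div i x.
Proof.
move=> Ax; have v0 : v x != 0 by rewrite gt_eqF// v_gt0.
have -> : lambda = - (laplacian v x / v x) by rewrite -mulNr v_eq// mulfK.
rewrite mulr_sumr mulr_suml mulNr mulr_suml -sumrB.
apply: ler_sum => i _.
have := trunc_form_ge0 e (partial i f x) (partial i v x / v x) (f_gt0 Ax).
rewrite /flux_div; set p := partial i v x / v x; set q := partial i (partial i v) x / v x.
move=> ?; lra.
Qed.

Lemma truncated_laplacian_bounded :
  box_bounded M (ext0 A (fun x => trunc_dsq e (f x) * laplacian f x)).
Proof.
have lap0 y : A y -> ~ K y -> trunc_dsq e (f y) * laplacian f y = 0.
  by move=> Ay /(off_K Ay) fe; rewrite trunc_dsq_eq0 ?mul0r.
apply: continuous_box_bounded; apply: (ext0_continuous Aopen Kclosed KA) lap0.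
move=> x Ax; apply: continuousM; first exact: comp_cont Ax (continuous_trunc_dsq (e := e)).
apply: (@continuous_at_sum _ _ _ _ (fun i => partial i (partial i f))) => i.
exact: fDDc.
Qed.

(** The Rayleigh quotient bound: replaces the inequality between the Dirichlet
    integral of w = G (f) and lambda times the integral of w ^ 2. *)
Lemma dirichlet_energy :
  mean (ext0 A (fun x => trunc_dsq e (f x) * laplacian f x)) +
    lambda * mean (ext0 A (fun x => trunc_sq e (f x))) <= 0.
Proof.
have sq0 y : A y -> ~ K y -> trunc_sq e (f y) = 0.
  by move=> Ay /(off_K Ay); exact: trunc_sq_eq0.
have b1 : box_bounded M (ext0 A (fun x => trunc_sq e (f x))).
  apply: continuous_box_bounded; apply: (ext0_continuous Aopen Kclosed KA) sq0.
  by move=> x Ax; exact: comp_cont Ax (continuous_trunc_sq (e := e)).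
have b2 := truncated_laplacian_bounded.
have b3 i : box_bounded M (ext0 A (flux_div i)).
  have cont := ext0_continuous Aopen Kclosed KA (@flux_div_continuous i) (@flux_div0 i).
  by apply: continuous_box_bounded; exact cont.
have <- : mean (fun x => \sum_(i < N) ext0 A (flux_div i) x) = 0.
  by rewrite mean_sum// big1// => i _; exact: flux_div_mean.
rewrite -meanZ// -meanD//; last exact: box_boundedZ.
apply: mean_le => //.
- by apply: box_boundedD => //; exact: box_boundedZ.
- exact: box_bounded_sum.
move=> x _; have [Ax|Ax] := pselect (A x); last first.
  by rewrite /= !ext0_out// mulr0 addr0 big1// => i _; rewrite ext0_out.
rewrite /= !ext0_in//; apply: le_trans (flux_div_ge Ax) _.
by apply: ler_sum => i _; rewrite ext0_in.
Qed.

End DirichletEnergy.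

(** * Evolution of the truncated energy *)

Lemma continuous_pair_l (X Y : topologicalType) (t : Y) :
  continuous (fun x : X => (x, t)).
Proof. by move=> x; apply: cvg_pair => /=; [exact: cvg_id|exact: cvg_cst]. Qed.

Lemma continuous_pair_r (X Y : topologicalType) (x : X) :
  continuous (fun t : Y => (x, t)).
Proof. by move=> t; apply: cvg_pair => /=; [exact: cvg_cst|exact: cvg_id]. Qed.

Section TruncatedEnergy.
Variables (R : realType) (N : nat) (U : set_system nat).
Hypotheses (UU : UltraFilter U) (ooU : \oo `<=` U).
Variables (M : nat) (D mu : R) (Q : set ('rV[R]_N * R)) (psi : 'rV[R]_N -> R -> R).
Hypotheses (D_gt0 : 0 < D) (Qopen : open Q) (psiC21 : C21 Q psi)
  (psi_gt0 : forall x t, Q (x, t) -> 0 < psi x t)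
  (psi_heat : forall x t, Q (x, t) ->
     derive1 (psi x) t = D * laplacian (psi^~ t) x + mu * psi x t)
  (Kclosed : forall e, 0 < e -> closed [set p | Q p /\ e <= psi p.1 p.2]).

Local Notation mean := (mean U M).
Local Notation slice t := [set x | Q (x, t)].

Definition energy_density e (x : 'rV[R]_N) (t : R) : R :=
  ext0 (slice t) (fun y => trunc_sq e (psi y t)) x.

(** Time derivative of energy_density. *)
Definition energy_rate_density e (x : 'rV[R]_N) (t : R) : R :=
  ext0 (slice t) (fun y => 2 * trunc_dsq e (psi y t) * derive1 (psi y) t) x.

Definition energy e t : R := mean (energy_density e ^~ t).

(** Extension by zero commutes with restriction to a slice, so that the same
    density can be studied in space, in time and in space-time. *)
Lemma ext0_comp (X Y : Type) (A : set Y) (g : X -> Y) (f : Y -> R) x :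
  ext0 (g @^-1` A) (f \o g) x = ext0 A f (g x).
Proof.
have [Ax|Ax] := pselect (A (g x)); first by rewrite !ext0_in.
by rewrite !ext0_out.
Qed.

Section FixedLevel.
Variable e : R.
Hypothesis e0 : 0 < e.

Let K := [set p : 'rV[R]_N * R | Q p /\ e <= psi p.1 p.2].
Let KQ : K `<=` Q. Proof. by move=> p []. Qed.
Let off_K p : Q p -> ~ K p -> psi p.1 p.2 <= e.
Proof.
by move=> Qp Kp; rewrite leNgt; apply/negP => ef; apply: Kp; split => //; exact: ltW.
Qed.

Lemma energy_density_continuous :
  continuous (fun p : 'rV[R]_N * R => energy_density e p.1 p.2).
Proof.
rewrite (_ : (fun p => _) = ext0 Q (fun p => trunc_sq e (psi p.1 p.2))); last first.
  by apply/funext => -[x t]; rewrite -(ext0_comp Q (fun x => (x, t))).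
apply: (ext0_continuous Qopen (Kclosed e0) KQ).
  case=> x t Qxt; apply: (@continuous_comp _ _ _ (fun p : 'rV[R]_N * R => psi p.1 p.2)).
    by have [] := psiC21 Qxt.
  exact/continuous_trunc_sq/psi_gt0.
by move=> p Qp /(off_K Qp); exact: trunc_sq_eq0.
Qed.

Lemma energy_rate_density_continuous :
  continuous (fun p : 'rV[R]_N * R => energy_rate_density e p.1 p.2).
Proof.
rewrite (_ : (fun p => _) =
  ext0 Q (fun p => 2 * trunc_dsq e (psi p.1 p.2) * derive1 (psi p.1) p.2)); last first.
  by apply/funext => -[x t]; rewrite -(ext0_comp Q (fun x => (x, t))).
apply: (ext0_continuous Qopen (Kclosed e0) KQ).
  case=> x t Qxt; have [psic [_ psit] _ _] := psiC21 Qxt.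
  apply: continuousM => //; apply: continuousM; first exact: cst_continuous.
  apply: (@continuous_comp _ _ _ (fun p : 'rV[R]_N * R => psi p.1 p.2)) => //.
  exact/continuous_trunc_dsq/psi_gt0.
by move=> p Qp /(off_K Qp) pe; rewrite trunc_dsq_eq0// mulr0 mul0r.
Qed.

Lemma slice_continuous (f : 'rV[R]_N -> R -> R) t :
  continuous (fun p : 'rV[R]_N * R => f p.1 p.2) -> continuous (f^~ t).
Proof.
move=> fc x; apply: (@continuous_comp _ _ _ (fun x => (x, t))
  (fun p : 'rV[R]_N * R => f p.1 p.2)); last exact: fc.
exact: continuous_pair_l.
Qed.

Lemma energy_density_is_derive x t :
  is_derive t (1 : R) (energy_density e x) (energy_rate_density e x t).
Proof.
pose A := [set s | Q (x, s)].
have pair_cont : continuous (fun s : R => (x, s)).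
  exact: continuous_pair_r.
have -> : energy_density e x = ext0 A (fun s => trunc_sq e (psi x s)).
  apply/funext => s; rewrite /energy_density.
  by rewrite (ext0_comp Q (fun x => (x, s)) (fun p => trunc_sq e (psi p.1 p.2)))
    -(ext0_comp Q (fun s => (x, s))).
have -> : energy_rate_density e x t =
    ext0 A (fun s => 2 * trunc_dsq e (psi x s) * derive1 (psi x) s) t.
  rewrite /energy_rate_density.
  by rewrite (ext0_comp Q (fun x => (x, t))
     (fun p => 2 * trunc_dsq e (psi p.1 p.2) * derive1 (psi p.1) p.2))
    -(ext0_comp Q (fun s => (x, s))).
apply: (@ext0_is_derive _ _ A [set s | K (x, s)]).
- by apply: open_comp => // s _; exact: pair_cont.
- by apply: (@closed_comp _ _ (fun s => (x, s)) K); [move=> s _; exact: pair_cont|exact: Kclosed].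
- by move=> s /KQ.
- move=> s Qxs; have [_ [psit _] _ _] := psiC21 Qxs.
  have psiD : is_derive s (1 : R) (psi x) (derive1 (psi x) s).
    by rewrite derive1E; exact: derivableP.
  exact: (is_derive_comp1 psiD (is_derive_trunc_sq e (psi_gt0 Qxs))).
- by move=> s Qs /(off_K Qs); exact: trunc_sq_eq0.
- by move=> s Qs /(off_K Qs) pe; rewrite trunc_dsq_eq0// mulr0 mul0r.
Qed.

Lemma energy_density_bounded t : box_bounded M (energy_density e ^~ t).
Proof. exact/continuous_box_bounded/slice_continuous/energy_density_continuous. Qed.

Lemma energy_rate_density_bounded t : box_bounded M (energy_rate_density e ^~ t).
Proof. exact/continuous_box_bounded/slice_continuous/energy_rate_density_continuous. Qed.

Lemma energy_is_derive t :
  is_derive t (1 : R) (energy e) (mean (energy_rate_density e ^~ t)).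
Proof.
have dE x s : derive1 (energy_density e x) s = energy_rate_density e x s.
  by rewrite derive1E; exact: (@derive_val _ _ _ _ _ _ _ (energy_density_is_derive x s)).
have dEt : energy_rate_density e ^~ t = (fun x => derive1 (energy_density e x) t).
  by apply/funext => x; rewrite dE.
rewrite dEt; apply: mean_derive => //.
- by apply: filterE => s; exact: energy_density_bounded.
- by rewrite -dEt; exact: energy_rate_density_bounded.
- by move=> x; apply: filterE => p;
    exact: (@ex_derive _ _ _ _ _ _ _ (energy_density_is_derive _ _)).
- move=> x; have -> : (fun p : 'rV[R]_N * R => derive1 (energy_density e p.1) p.2) =
     (fun p => energy_rate_density e p.1 p.2) by apply/funext => p; exact: dE.
  exact: energy_rate_density_continuous.
Qed.

Lemma energy_rate_continuous : continuous (fun t => mean (energy_rate_density e ^~ t)).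
Proof.
move=> t; apply: mean_cvg_unif => //.
- exact: energy_rate_density_bounded.
- by apply: filterE => s; exact: energy_rate_density_bounded.
move=> d x d0 _.
have d20 : 0 < d / 2 by rewrite divr_gt0.
have := @energy_rate_density_continuous (x, t) => /cvgrPdistC_le/(_ _ d20).
case=> -[A B] /= [Ax Bt] AB; exists (A, B) => //=.
case=> y s [/= Ay Bs].
have h1 := AB (y, s) (conj Ay Bs).
have h2 := AB (y, t) (conj Ay (nbhs_singleton Bt)).
apply: le_trans (ler_distD (energy_rate_density e x t) _ _) _.
rewrite (distrC (energy_rate_density e x t)) [leRHS](splitr d); exact: lerD.
Qed.

(** Insert the heat equation into the rate 2 G G' psi_t, bound the Laplacian term
    by dirichlet_energy, and use psi G G' <= G ^ 2 + 3 e G together with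
    2 G <= 1 + G ^ 2. *)
Lemma energy_rate_le t (lambda : R) (v : 'rV[R]_N -> R) :
  (forall x, Q (x, t) -> `|x| < M%:R) ->
  C2 (slice t) v -> (forall x, Q (x, t) -> 0 < v x) ->
  (forall x, Q (x, t) -> - laplacian v x = lambda * v x) ->
  mean (energy_rate_density e ^~ t) <=
    2 * (mu - D * lambda) * energy e t + 4 * e * `|mu| * (1 + energy e t).
Proof.
move=> Qbox vC2 v0 veq.
have pt_cont : continuous (fun x : 'rV[R]_N => (x, t)) by exact: continuous_pair_l.
have sliceO : open (slice t) by apply: open_comp => // s _; exact: pt_cont.
have psiC2 : C2 (slice t) (psi^~ t).
  move=> x Qxt; have [psic _ psix psixx] := psiC21 Qxt.
  have cont (f : 'rV[R]_N -> R -> R) :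
      {for (x, t), continuous (fun p : 'rV[R]_N * R => f p.1 p.2)} ->
      {for x, continuous (f^~ t)}.
    by apply: (@continuous_comp _ _ _ (fun x => (x, t))); exact: pt_cont.
  split; first exact: cont.
    move=> i; split; first exact: (psix i).1.
    exact: (cont (fun x t => partial i (psi^~ t) x) (psix i).2).
  move=> i j; split; first exact: (psixx i j).1.
  exact: (cont (fun x t => partial j (partial i (psi^~ t)) x) (psixx i j).2).
have sliceK : closed [set x | slice t x /\ e <= psi x t].
  by apply: (@closed_comp _ _ (fun x => (x, t)) K); [move=> s _; exact: pt_cont|exact: Kclosed].
have psi0 x : slice t x -> 0 < psi x t by exact: psi_gt0.
have := @dirichlet_energy R N U UU ooU M e lambda (slice t) (psi^~ t) v
  sliceO psiC2 vC2 psi0 v0 veq sliceK Qbox.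
set Hlap := ext0 _ _ => Dir.
have Hlap_bounded : box_bounded M Hlap.
  exact: (truncated_laplacian_bounded M sliceO psiC2 psi0 sliceK).
have bE := energy_density_bounded t.
have b1 : box_bounded M (fun _ : 'rV[R]_N => 1 : R) by exists 1 => x _; rewrite normr1.
have mean1 : mean (fun _ : 'rV[R]_N => 1 : R) = 1.
  apply: meanE; under eq_fun do rewrite grid_mean_cst; exact: cvg_cst.
(* Pointwise bound whose mean is controlled by the energy inequality. *)
pose bound := (fun x => 2 * D * Hlap x) \+
  ((fun x => (2 * mu + 4 * e * `|mu|) * energy_density e x t) \+ (fun x => 4 * e * `|mu| * 1)).
have bZ2 := box_boundedZ (2 * mu + 4 * e * `|mu|) bE.
have bZ3 := box_boundedZ (4 * e * `|mu|) b1.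
have bZ1 := box_boundedZ (2 * D) Hlap_bounded.
have bZ23 := box_boundedD bZ2 bZ3.
have : mean (energy_rate_density e ^~ t) <= mean bound.
  apply: mean_le => //; first exact: energy_rate_density_bounded.
    exact: box_boundedD.
  move=> x _; rewrite /bound /=.
  have c0 : 0 <= 4 * e * `|mu| by rewrite mulr_ge0// mulr_ge0// ltW.
  have [Qx|Qx] := pselect (Q (x, t)); last first.
    by rewrite /energy_rate_density /energy_density /Hlap !ext0_out// !mulr0 !add0r mulr1.
  rewrite /energy_rate_density /energy_density /Hlap !ext0_in// psi_heat//.
  have /andP[lo hi] := trunc_dsq_bounds e0 (psi_gt0 Qx).
  have sq : 2 * trunc e (psi x t) <= 1 + trunc_sq e (psi x t).
    by rewrite trunc_sqE; have := sqr_ge0 (trunc e (psi x t) - 1); rewrite sqrrB1; lra.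
  have tr : mu * (psi x t * trunc_dsq e (psi x t)) <=
     mu * trunc_sq e (psi x t) + 2 * e * `|mu| * (1 + trunc_sq e (psi x t)).
    have H0 : 0 <= 2 * e * `|mu| * (1 + trunc_sq e (psi x t)).
      by rewrite mulr_ge0// ?addr_ge0// ?trunc_sqE ?sqr_ge0// mulr_ge0// mulr_ge0// ltW.
    have [mu0|mu0] := lerP 0 mu; last first.
      by have := ler_wnM2l (ltW mu0) lo; lra.
    rewrite (ger0_norm mu0) in H0 *.
    have := ler_wpM2l (mulr_ge0 mu0 (ltW e0)) sq.
    by have := ler_wpM2l mu0 hi; lra.
  set H := trunc_dsq _ _ in tr *; set L := laplacian _ _; set G := trunc_sq _ _ in tr *.
  rewrite (_ : 2 * H * (D * L + mu * psi x t) = 2 * D * (H * L) + 2 * (mu * (psi x t * H))); last by ring.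
  lra.
move=> /le_trans; apply.
rewrite /bound meanD// meanD// !meanZ// mean1 -/(energy e t).
have : D * (mean Hlap + lambda * energy e t) <= 0 by rewrite pmulr_rle0.
lra.
Qed.

Lemma energy_density_ge0 x t : 0 <= energy_density e x t.
Proof.
rewrite /energy_density; have [Qx|Qx] := pselect (Q (x, t)); last by rewrite ext0_out.
by rewrite ext0_in// trunc_sqE sqr_ge0.
Qed.

(** The density is continuous and positive at some point, hence bounded below on a
    ball around it. *)
Lemma energy_gt0 t : (forall x, Q (x, t) -> `|x| < M%:R) ->
  (exists2 x, Q (x, t) & e < psi x t) -> 0 < energy e t.
Proof.
move=> Qbox [x0 Qx0 ex0].
have dens0 : 0 < energy_density e x0 t.
  by rewrite /energy_density ext0_in// trunc_sqE exprn_gt0// trunc_gt0.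
have d20 : 0 < energy_density e x0 t / 2 by rewrite divr_gt0.
have := @slice_continuous _ t energy_density_continuous x0 => /cvgrPdist_le/(_ _ d20).
move=> /nbhs_ballP[r /= r0 rP].
pose r' := Num.min (r / 2) (M%:R - `|x0|).
have r'0 : 0 < r' by rewrite lt_min divr_gt0//= subr_gt0 Qbox.
apply: (@mean_gt0 R N U UU ooU M _ x0 r' (energy_density e x0 t / 2)) => //.
- exact: energy_density_bounded.
- by rewrite -lerBrDl ge_min lexx orbT.
- by move=> x _; exact: energy_density_ge0.
move=> x xr; have : ball x0 r x.
  rewrite -ball_normE /ball_ /= distrC; apply: le_lt_trans xr _.
  by rewrite gt_min ltr_pdivrMr// ltr_pMr// ltr1n.
by move=> /rP; rewrite ler_norml => /andP[_]; rewrite /=; lra.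
Qed.

End FixedLevel.

Lemma energy_antitone e e' t : 0 < e -> e <= e' -> energy e' t <= energy e t.
Proof.
move=> e0 ee; have e'0 := lt_le_trans e0 ee.
apply: mean_le => //; try exact: energy_density_bounded.
move=> x _; rewrite /energy_density.
have [Qx|Qx] := pselect (Q (x, t)); last by rewrite !ext0_out.
rewrite !ext0_in// !trunc_sqE lerXn2r ?nnegrE ?trunc_ge0//.
exact/trunc_anti/psi_gt0.
Qed.

End TruncatedEnergy.

(** * Integrals of functions that need not be measurable *)

(** The integral of a nonnegative function is a supremum over the simple functions
    below it, which is monotone even for functions that are not measurable. *)
Lemma le_integral_pointwise d (T : measurableType d) (R : realType)
    (mu : {measure set T -> \bar R}) (D : set T) (f g : T -> \bar R) :
  (forall x, D x -> (f x <= g x)%E) ->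
  (\int[mu]_(x in D) f x <= \int[mu]_(x in D) g x)%E.
Proof.
move=> fg; have fgD x : (patch (fun=> 0%E) D f x <= patch (fun=> 0%E) D g x)%E.
  by rewrite /patch; case: ifPn => // /[!inE]; exact: fg.
rewrite /integral; apply: leeB; apply: le_ereal_sup => _ [h hf <-];
  exists h => // x; apply: le_trans (hf x) _.
  by rewrite !funeposE ge_max !le_max lexx orbT andbT fgD.
by rewrite !funenegE ge_max !le_max lexx orbT andbT leeN2 fgD.
Qed.

Lemma integral_le_primitive (R : realType) (f g F : R -> R) (a b : R) : a < b ->
  (forall t, a <= t <= b -> f t <= g t) ->
  (forall t, a <= t <= b -> is_derive t (1 : R) F (g t)) ->
  (forall t, a <= t <= b -> {for t, continuous g}) ->
  (\int[lebesgue_measure]_(t in `[a, b]) (f t)%:E <= (F b - F a)%:E)%E.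
Proof.
move=> ab fg FD gc.
have Fc t : a <= t <= b -> {for t, continuous F}.
  by move=> /FD[/derivable1_diffP/differentiable_continuous].
have -> : ((F b - F a)%:E = \int[lebesgue_measure]_(t in `[a, b]) (g t)%:E)%E.
  rewrite (@continuous_FTC2 _ g F)//.
  - apply: continuous_in_subspaceT => t; rewrite inE /= in_itv /=; exact: gc.
  - split.
    + move=> t; rewrite in_itv /= => /andP[at_ tb].
      by have [] // := FD t _; rewrite !ltW.
    + by apply: cvg_at_right_filter; apply: Fc; rewrite lexx ltW.
    + by apply: cvg_at_left_filter; apply: Fc; rewrite lexx ltW.
  - move=> t; rewrite in_itv /= => /andP[at_ tb].
    by rewrite derive1E; apply: derive_val; apply: FD; rewrite !ltW.
apply: le_integral_pointwise => t /=; rewrite in_itv /= lee_fin; exact: fg.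
Qed.

(** * Periodic domains and their principal eigenfunctions *)

(** A cluster point p with f p < e would have a neighbourhood in A that misses the
    superlevel set. *)
Lemma compact_superlevel (R : realType) (X : topologicalType) (A : set X)
    (f : X -> R) (e : R) : compact A -> {within A, continuous f} ->
  compact [set x | A x /\ e <= f x].
Proof.
move=> Ac fc F FF FS.
have FA : F A by apply: filterS FS => x [].
have [p [Ap Fp]] := Ac F FF FA.
exists p; split => //; split => //.
rewrite leNgt; apply/negP => pe.
have near_lt : within A (nbhs p) [set y | f y < e].
  have := (@subspace_continuousP _ _ _ f).1 fc p Ap.
  by move/cvgr_lt; exact.
have [y [[Ay ey] /(_ Ay)]] := Fp _ _ FS near_lt.
by rewrite /= ltNge ey.
Qed.

Lemma compact_closure_bounded (R : realType) (N : nat) (A : set 'rV[R]_N) :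
  bounded_set A -> compact (closure A).
Proof.
move=> [c [_ cP]]; apply: bounded_closed_compact; last exact: closed_closure.
have sub : closure A `<=` [set x | `|x| <= c + 1].
  rewrite (_ : [set x | _] = closure [set x : 'rV[R]_N | `|x| <= c + 1]).
    by apply: closureS => x Ax; apply: cP => //; rewrite ltrDl.
  apply/closure_id.
  rewrite (_ : [set x : 'rV[R]_N | _] = Num.norm @^-1` [set r : R | r <= c + 1]) //.
  by apply: closed_comp; [move=> x _; exact: norm_continuous|exact: closed_le].
exists (c + 1); split; first exact: num_real.
by move=> r cr x /sub xc; exact: le_trans xc (ltW cr).
Qed.

Section PeriodicDomain.
Variables (R : realType) (N : nat) (D T : R) (Omega : R -> set 'rV[R]_N)
  (Omega0 : set 'rV[R]_N) (h hinv : 'rV[R]_N -> R -> 'rV[R]_N).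
Hypothesis PD : periodic_domain D T Omega Omega0 h hinv.

Local Notation spacetime := [set p : 'rV[R]_N * R | Omega p.2 p.1].

Lemma reference_open : open Omega0.
Proof. by have [] := pd_ref_domain PD. Qed.

Lemma h_in x t : Omega t x -> Omega0 (h x t).
Proof. by move=> Ox; rewrite -(pd_image PD t); exists x. Qed.

Lemma h_inK x t : Omega t x -> hinv (h x t) t = x.
Proof. by move=> Ox; have [] := pd_hK PD (subset_closure Ox). Qed.

Lemma hinv_in xi t : Omega0 xi -> Omega t (hinv xi t).
Proof. by rewrite -{1}(pd_image PD t) => -[x Ox <-]; rewrite h_inK. Qed.

Lemma hinv_inK xi t : Omega0 xi -> h (hinv xi t) t = xi.
Proof. by move=> Oxi; have [] := pd_hinvK PD t (subset_closure Oxi). Qed.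

Lemma cylinder_compact (a b : R) : compact (closure Omega0 `*` `[a, b]).
Proof.
apply: compact_setX; last exact: segment_compact.
by apply: compact_closure_bounded; have [] := pd_ref_domain PD.
Qed.

Lemma hinv_continuous (a b : R) : {within closure Omega0 `*` `[a, b],
  continuous (fun p : 'rV[R]_N * R => hinv p.1 p.2)}.
Proof. by apply: continuous_subspaceW (pd_contV PD) => p []. Qed.

(** The domains for t in [a, b] lie in the image of a compact cylinder under the
    continuous map hinv. *)
Lemma domains_bounded (a b : R) :
  exists M : nat, forall x t, a <= t <= b -> Omega t x -> `|x| < M%:R.
Proof.
have := continuous_compact (@hinv_continuous a b) (@cylinder_compact a b).
move=> /compact_bounded[c [_ cP]].
exists (Num.truncn (`|c| + 1)).+1 => x t tab Ox.
apply: le_lt_trans (truncnS_gt (`|c| + 1)).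
apply: (cP (`|c| + 1)).
  by apply: le_lt_trans (ler_norm _) _; rewrite ltrDl.
exists (h x t, t); last by rewrite /= h_inK.
by split => /=; [exact/subset_closure/h_in|rewrite in_itv].
Qed.

Section Eigenfunction.
Variable phi : 'rV[R]_N -> R -> R.
Hypotheses (phi_cont : {within closure Omega0 `*` [set: R],
     continuous (fun p : 'rV[R]_N * R => phi p.1 p.2)})
  (phi_bd : forall xi t, boundary Omega0 xi -> phi xi t = 0).

Local Notation psi := (pullback h phi).

(** A limit of points of the superlevel set cannot leave the moving domain: in
    the reference cylinder the limit exists by compactness, and it is not on the
    boundary because phi vanishes there. *)
Lemma superlevel_closed e : 0 < e ->
  closed [set p : 'rV[R]_N * R | spacetime p /\ e <= psi p.1 p.2].
Proof.
move=> e0 [x t] xtK.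
(* Near time t the superlevel set is the image of a compact set under the
   inverse of the straightening maps. *)
pose S := [set p : 'rV[R]_N * R | (closure Omega0 `*` `[t - 1, t + 1]) p /\ e <= phi p.1 p.2].
have Sc : compact S.
  apply: compact_superlevel; first exact: cylinder_compact.
  by apply: continuous_subspaceW phi_cont => p [].
pose m (p : 'rV[R]_N * R) := (hinv p.1 p.2, p.2).
have mc : {within S, continuous m}.
  have hc : {within S, continuous (fun p : 'rV[R]_N * R => hinv p.1 p.2)}.
    by apply: continuous_subspaceW (pd_contV PD) => q [[]].
  apply/subspace_continuousP => p Sp.
  have m1 := (@subspace_continuousP _ _ _ _).1 hc p Sp.
  have m2 : (fun q : 'rV[R]_N * R => q.2) @ within S (nbhs p) --> p.2.
    by apply: cvg_within_filter; exact: cvg_snd.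
  exact: (cvg_pair m1 m2).
have imc : closed (m @` S).
  apply: compact_closed; first exact: norm_hausdorff.
  exact: continuous_compact.
have imK p : (m @` S) p -> spacetime p /\ e <= psi p.1 p.2.
  move=> [[xi s] [[/= clxi _] exi] <-] /=.
  have Oxi : Omega0 xi.
    apply: contrapT => Oxi; have : phi xi s = 0.
      by apply: phi_bd; split => // /interior_subset.
    by move=> phi0; move: exi; rewrite phi0 leNgt e0.
  by split; [exact: hinv_in|rewrite /pullback hinv_inK].
apply: imK; apply: imc => B Bxt.
have Wxt : nbhs (x, t) (B `&` [set p : 'rV[R]_N * R | p.2 \in `[t - 1, t + 1]%R]).
  apply: filterI => //.
  exists (setT, ball t 1) => /=; first by split; [exact: filterT|exact: nbhsx_ballx].
  case=> y s /= [_]; rewrite /ball /= in_itv /= ltr_distlC => /andP[] *.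
  by apply/andP; split; lra.
have [[y s] [[Oy ey] [By sW]]] := xtK _ Wxt.
exists (y, s); split => //; exists (h y s, s); last by rewrite /m /= h_inK.
by split => //; split => //; exact/subset_closure/h_in.
Qed.

End Eigenfunction.
End PeriodicDomain.

(** * The inequality between the eigenvalues *)

(** Gronwall's argument: E' / (2 E) is half the derivative of ln E, whose integral
    over a period is 0. The lower bound c absorbs the additive error. *)
Lemma integral_le_of_energy (R : realType) (T mu e c : R) (f E E' : R -> R) :
  0 < T -> 0 < e -> 0 < c ->
  (forall t, is_derive t (1 : R) E (E' t)) -> continuous E' -> E T = E 0 ->
  (forall t, 0 <= t <= T -> c <= E t) ->
  (forall t, 0 <= t <= T ->
     E' t <= 2 * (mu - f t) * E t + 4 * e * `|mu| * (1 + E t)) ->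
  (\int[lebesgue_measure]_(t in `[0%R, T]) (f t)%:E <=
     (T * (mu + 2 * e * `|mu| * (1 + c^-1)))%:E)%E.
Proof.
move=> T0 e0 c0 ED E'c Eper Ec EE.
set a := mu + _.
have E0 t : 0 <= t <= T -> 0 < E t by move=> /Ec; exact: lt_le_trans.
(* Dividing the differential inequality by 2 E bounds f by the derivative of F. *)
pose F t := a * t - ln (E t) / 2.
pose g t := a - (E t)^-1 * E' t / 2.
have fg t : 0 <= t <= T -> f t <= g t.
  move=> tT; have Et := E0 t tT.
  have Em0 : 0 < 2 * E t by rewrite mulr_gt0.
  have En0 : E t != 0 by rewrite gt_eqF.
  have Vc : (E t)^-1 <= c^-1 by rewrite lef_pV2 ?posrE//; exact: Ec.
  have em0 : 0 <= 2 * e * `|mu| by rewrite mulr_ge0// mulr_ge0// ltW.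
  rewrite /g /a -(ler_pM2l Em0).
  have -> : 2 * E t * (mu + 2 * e * `|mu| * (1 + c^-1) - (E t)^-1 * E' t / 2) =
     2 * E t * (mu + 2 * e * `|mu| * (1 + c^-1)) - E' t.
    by field; rewrite En0 gt_eqF.
  have : 2 * E t * (2 * e * `|mu| * (E t)^-1) <= 2 * E t * (2 * e * `|mu| * c^-1).
    by apply: ler_wpM2l; [exact: ltW|exact: ler_wpM2l].
  have -> : 2 * E t * (2 * e * `|mu| * (E t)^-1) = 4 * e * `|mu| by field.
  by have := EE t tT; lra.
have FD t : 0 <= t <= T -> is_derive t (1 : R) F (g t).
  move=> tT; have lnD := is_derive_comp1 (ED t) (is_derive1_ln (E0 t tT)).
  have idD := is_derive_id t (1 : R).
  have := is_deriveB (is_deriveZ a idD) (is_deriveZ 2^-1 lnD).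
  rewrite (_ : a *: id - _ = F); last first.
    apply/funext => s; rewrite /F; congr (_ - _); exact: mulrC.
  by rewrite /g [_ *: 1]mulr1 [_ *: (_ * _)]mulrC.
have gc t : 0 <= t <= T -> {for t, continuous g}.
  move=> tT.
  have Etc : {for t, continuous E}.
    by have [/derivable1_diffP/differentiable_continuous] := ED t.
  apply: continuousB; first exact: cst_continuous.
  apply: continuousM; last exact: cst_continuous.
  by apply: continuousM; [apply: continuousV; rewrite ?gt_eqF ?E0|exact: E'c].
have := integral_le_primitive T0 fg FD gc.
by rewrite (_ : F T - F 0 = T * a)// /F Eper; ring.
Qed.

Section Periodicity.
Variables (R : realType) (N : nat) (D T : R) (Omega : R -> set 'rV[R]_N)
  (Omega0 : set 'rV[R]_N) (h hinv : 'rV[R]_N -> R -> 'rV[R]_N).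
Hypothesis PD : periodic_domain D T Omega Omega0 h hinv.
Variables (phi : 'rV[R]_N -> R -> R) (U : set_system nat) (M : nat) (e : R).
Hypothesis phi_per : forall xi t, closure Omega0 xi -> phi xi (t + T) = phi xi t.

Lemma energy_periodic t :
  energy U M [set p | Omega p.2 p.1] (pullback h phi) e (t + T) =
  energy U M [set p | Omega p.2 p.1] (pullback h phi) e t.
Proof.
rewrite /energy; congr mean; apply/funext => x; rewrite /energy_density /=.
rewrite (pd_periodic PD t).
have [Ox|Ox] := pselect (Omega t x); last by rewrite !ext0_out.
rewrite !ext0_in//; congr trunc_sq; rewrite /pullback.
rewrite (pd_h_periodic PD (subset_closure Ox)) phi_per//.
exact/subset_closure/(h_in PD).
Qed.

End Periodicity.

Theorem theorem1 (R : realType) (N : nat) (D T : R)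
    (Omega : R -> set 'rV[R]_N) (Omega0 : set 'rV[R]_N)
    (h hinv : 'rV[R]_N -> R -> 'rV[R]_N)
    (mu : R) (lambda : set 'rV[R]_N -> R)
    (N_gt0 : (0 < N)%N) (D_gt0 : 0 < D) (T_gt0 : 0 < T)
    (Omega_periodic : periodic_domain D T Omega Omega0 h hinv)
    (mu_principal : principal_periodic_eigenvalue D T Omega0 h hinv mu)
    (lambda_principal : forall t, 0 <= t <= T ->
       dirichlet_principal_eigenvalue (Omega t) (lambda (Omega t))) :
  ((T^-1)%:E * \int[lebesgue_measure]_(t in `[0%R, T]) (D * lambda (Omega t))%:E
     <= mu%:E)%E.
Proof.
have [phi [[phiC21 phi_cont] phi_eq phi_bd phi_gt0 phi_per]] := mu_principal.
have PD := Omega_periodic.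
pose Q := [set p : 'rV[R]_N * R | Omega p.2 p.1].
pose psi := pullback h phi.
have Qopen : open Q := pd_open PD.
have O0open := reference_open PD.
have hQ x t : Q (x, t) -> Omega0 (h x t) by exact: (h_in PD).
have psiC21 : C21 Q psi by exact: (pullback_C21 Qopen O0open hQ (pd_C21 PD) phiC21).
have psi_gt0 x t : Q (x, t) -> 0 < psi x t by move=> /hQ; exact: phi_gt0.
have psi_heat x t : Q (x, t) ->
    derive1 (psi x) t = D * laplacian (psi^~ t) x + mu * psi x t.
  apply: (pullback_heat Qopen O0open hQ (pd_C21 PD) phiC21 _ phi_eq) => y s.
  exact: (h_inK PD).
have Kclosed e : 0 < e -> closed [set p | Q p /\ e <= psi p.1 p.2].
  exact: (superlevel_closed PD phi_cont phi_bd).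
have [M Mbox] := domains_bounded PD 0 T.
have [U [UU ooU]] := @ultraFilterLemma nat \oo _.
pose E := energy U M Q psi.
pose E' e t := mean U M (energy_rate_density Q psi e ^~ t).
have [xi0 Oxi0] : Omega0 !=set0 by have [] := pd_ref_domain PD.
have phi_xi0_cont : {within `[0, T], continuous (phi xi0)}.
  apply: derivable_within_continuous => t _.
  by have [_ [phit _] _ _] := phiC21 xi0 t (conj Oxi0 I); exact: phit.
(* A level e1 below which the truncation leaves a positive energy at every time:
   along the curve hinv xi0 the eigenfunction stays above 2 * e1. *)
have [tm _ phi_min] := EVT_min (ltW T_gt0) phi_xi0_cont.
pose e1 := phi xi0 tm / 2.
have e1_gt0 : 0 < e1 by rewrite divr_gt0// phi_gt0.
have E1D t : is_derive t (1 : R) (E e1) (E' e1 t) by exact: energy_is_derive.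
have E1_cont : {within `[0, T], continuous (E e1)}.
  by apply: derivable_within_continuous => t _; have [] := E1D t.
have [tc tcT E_min] := EVT_min (ltW T_gt0) E1_cont.
have Mbox_t t : 0 <= t <= T -> forall x, Q (x, t) -> `|x| < M%:R.
  by move=> tT x; exact: Mbox.
have c_gt0 : 0 < E e1 tc.
  apply: energy_gt0 => //; first exact: Mbox_t.
  exists (hinv xi0 tc); first exact: (hinv_in PD).
  rewrite /psi /pullback (hinv_inK PD)//; apply: lt_le_trans (phi_min _ tcT).
  by rewrite /e1 ltr_pdivrMr// ltr_pMr ?phi_gt0// ltr1n.
have bound e : 0 < e -> e <= e1 ->
    (\int[lebesgue_measure]_(t in `[0%R, T]) (D * lambda (Omega t))%:E <=
      (T * (mu + 2 * e * `|mu| * (1 + (E e1 tc)^-1)))%:E)%E.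
  move=> e0 ee1.
  apply: (@integral_le_of_energy _ _ _ _ _ _ (E e) (E' e)) => //.
  - by move=> t; exact: energy_is_derive.
  - exact: energy_rate_continuous.
  - by have := energy_periodic PD U M e phi_per 0; rewrite add0r.
  - move=> t tT; apply: le_trans (E_min t _) _; first by rewrite in_itv.
    exact: energy_antitone.
  - move=> t tT; have [v [[vC2 _] veq _ v0]] := lambda_principal t tT.
    exact: (energy_rate_le UU ooU D_gt0 Qopen psiC21 psi_gt0 psi_heat Kclosed e0
      (Mbox_t t tT) vC2 v0 veq).
rewrite lee_pdivrMl//.
apply/lee_addgt0Pr => d d0.
pose k := T * (2 * `|mu| * (1 + (E e1 tc)^-1)).
have k0 : 0 <= k.
  by rewrite mulr_ge0 ?(ltW T_gt0)// mulr_ge0 ?mulr_ge0// addr_ge0// invr_ge0 ltW.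
pose e := Num.min e1 (d / (k + 1)).
have k1 : 0 < k + 1 by rewrite ltr_wpDl.
have e0 : 0 < e by rewrite lt_min e1_gt0 divr_gt0.
apply: le_trans (bound e e0 _) _; first by rewrite ge_min lexx.
rewrite -EFinM -EFinD lee_fin.
rewrite (_ : T * (mu + _) = T * mu + e * k); last by rewrite /k; ring.
rewrite lerD2l; apply: (@le_trans _ _ (d / (k + 1) * k)).
  by rewrite ler_wpM2r// ge_min lexx orbT.
by rewrite mulrAC ler_pdivrMr// ler_pM2l// lerDl.
Qed.
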